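(* Let $(M,\omega)$ be any closed symplectic manifold of dimension $2n$ and let $\rho$ be any Riemannian metric on $M$. For any $\epsilon>0$, let $\mathcal U^\epsilon$ be a finite cover of $M$ by open subsets of diameter at most $\epsilon$ (with respect to $\rho$). Then $$pb(\mathcal U^\epsilon)\longrightarrow\infty\quad\text{as }\epsilon\to0.$$
   Context: $\{\cdot,\cdot\}$ denotes the Poisson bracket on $C^\infty(M)$ induced by $\omega$, and $\|f\|=\max_M|f|$. A partition of unity $\{f_i\}_{i\in I}$ consists of smooth non-negative functions on $M$ with sum $1$; it is subordinate to $\mathcal U=\{U_i\}_{i\in I}$ if $\mathrm{supp}(f_i)\subset U_i$ for all $i$. The Poisson bracket invariant of a finite open cover $\mathcal U=\{U_i\}_{i\in I}$ is $$pb(\mathcal U):=\inf_{\mathcal F}\ \max_{x,y\in[-1,1]^{|I|}}\Big\|\Big\{\sum_{i\in I}x_if_i,\sum_{j\in I}y_jf_j\Big\}\Big\|,$$ the infimum being over all partitions of unity $\mathcal F=\{f_i\}_{i\in I}$ subordinate to $\mathcal U$. Here $n\ge1$. *)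

(* Defs.v *)
From HB Require Import structures.
From mathcomp Require Import all_boot all_order all_algebra.
From mathcomp Require Import all_classical all_reals all_analysis.

Set Implicit Arguments.
Unset Strict Implicit.
Unset Printing Implicit Defensive.

Import Order.TTheory GRing.Theory Num.Theory numFieldNormedType.Exports.

Local Open Scope classical_set_scope.
Local Open Scope ring_scope.

(* f is C^k on U; meant for U open, so that the derivatives at a point of U
   only depend on the restriction of f to U. *)
Fixpoint Ck_on (R : realType) (V W : normedModType R) (k : nat) (U : set V)
    (f : V -> W) : Prop :=
  match k with
  | 0%N => forall x, U x -> {for x, continuous f}
  | k'.+1 => (forall x, U x -> differentiable f x) /\
             (forall v, Ck_on k' U (fun x => 'D_v f x))
  end.

Definition smooth_on (R : realType) (V W : normedModType R) (U : set V)
    (f : V -> W) : Prop :=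
  forall k, Ck_on k U f.

(* The maps are total functions, only meaningful on chart_dom and on its
   image. *)
Record chart (R : realType) (m : nat) (M : topologicalType) := Chart {
  chart_dom : set M;
  chart_map : M -> 'rV[R]_m;
  chart_inv : 'rV[R]_m -> M;
  chart_dom_open : open chart_dom;
  chart_img_open : open (chart_map @` chart_dom);
  chart_mapK : {in chart_dom, cancel chart_map chart_inv};
  chart_map_cont : forall p, chart_dom p -> {for p, continuous chart_map};
  chart_inv_cont : forall y, (chart_map @` chart_dom) y ->
    {for y, continuous chart_inv} }.

Definition chart_img (R : realType) (m : nat) (M : topologicalType)
    (c : chart R m M) : set 'rV[R]_m :=
  chart_map c @` chart_dom c.

Definition transition (R : realType) (m : nat) (M : topologicalType)
    (c d : chart R m M) : 'rV[R]_m -> 'rV[R]_m :=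
  chart_map d \o chart_inv c.

(* The smooth structure is the one generated by the atlas. *)
Record smooth_atlas (R : realType) (m : nat) (M : topologicalType) := Atlas {
  atlas_index : Type;
  atlas_chart :> atlas_index -> chart R m M;
  atlas_cover : forall p, exists i, chart_dom (atlas_chart i) p;
  atlas_compat : forall i j,
    smooth_on (chart_map (atlas_chart i) @`
                 (chart_dom (atlas_chart i) `&` chart_dom (atlas_chart j)))
              (transition (atlas_chart i) (atlas_chart j)) }.

(* Second countability follows from compactness and the charts. *)
Definition closed_manifold (R : realType) (m : nat) (M : topologicalType)
    (A : smooth_atlas R m M) : Prop :=
  [/\ [set: M] !=set0, hausdorff_space M & compact [set: M]].

(* A choice of chart around each point. It is only used to evaluate
   expressions that do not depend on the chart. *)
Definition chart_at (R : realType) (m : nat) (M : topologicalType)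
    (A : smooth_atlas R m M) (p : M) : atlas_index A :=
  projT1 (cid (atlas_cover A p)).

Definition smooth_fun (R : realType) (m : nat) (M : topologicalType)
    (A : smooth_atlas R m M) (f : M -> R) : Prop :=
  forall i, smooth_on (chart_img (A i)) (f \o chart_inv (A i)).

(* Smooth covariant 2-tensor fields: T i y is the Gram matrix at y of the
   bilinear form in the coordinates of chart i. Vectors are rows, so the
   jacobian J of a map acts by u |-> u *m J, and pulling back the matrix G
   gives J *m G *m J^T. *)
Record tensor2 (R : realType) (m : nat) (M : topologicalType)
    (A : smooth_atlas R m M) := Tensor2 {
  tensor2_mx :> atlas_index A -> 'rV[R]_m -> 'M[R]_m;
  tensor2_smooth : forall i, smooth_on (chart_img (A i)) (tensor2_mx i);
  tensor2_compat : forall i j p,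
    chart_dom (A i) p -> chart_dom (A j) p ->
    let J := jacobian (transition (A i) (A j)) (chart_map (A i) p) in
    tensor2_mx i (chart_map (A i) p) =
      J *m tensor2_mx j (chart_map (A j) p) *m J^T }.

(* T_p(u, v), for tangent vectors u, v at p given in the coordinates of
   chart i. *)
Definition tensor2_eval (R : realType) (m : nat) (M : topologicalType)
    (A : smooth_atlas R m M) (T : tensor2 A) (i : atlas_index A) (p : M)
    (u v : 'rV[R]_m) : R :=
  (u *m T i (chart_map (A i) p) *m v^T) 0 0.

Definition partial (R : realType) (m : nat) (a : 'I_m) (f : 'rV[R]_m -> R)
    (y : 'rV[R]_m) : R :=
  'D_(delta_mx 0 a) f y.

Definition closed_form2 (R : realType) (m : nat) (M : topologicalType)
    (A : smooth_atlas R m M) (T : tensor2 A) : Prop :=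
  forall i y, chart_img (A i) y -> forall a b c : 'I_m,
    partial a (fun z => T i z b c) y + partial b (fun z => T i z c a) y
      + partial c (fun z => T i z a b) y = 0.

Record symplectic_form (R : realType) (m : nat) (M : topologicalType)
    (A : smooth_atlas R m M) := SymplecticForm {
  sform :> tensor2 A;
  sform_alternating : forall i y, chart_img (A i) y ->
    (sform i y)^T = - sform i y;
  sform_nondegenerate : forall i y, chart_img (A i) y ->
    sform i y \in unitmx;
  sform_closed : closed_form2 sform }.

Record riemannian_metric (R : realType) (m : nat) (M : topologicalType)
    (A : smooth_atlas R m M) := RiemannianMetric {
  rmetric :> tensor2 A;
  rmetric_symmetric : forall i y, chart_img (A i) y ->
    (rmetric i y)^T = rmetric i y;
  rmetric_posdef : forall i p (v : 'rV[R]_m), chart_dom (A i) p -> v != 0 ->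
    0 < tensor2_eval rmetric i p v v }.

Definition differential (R : realType) (m : nat) (M : topologicalType)
    (A : smooth_atlas R m M) (f : M -> R) (i : atlas_index A) (p : M) :
    'rV[R]_m :=
  \row_a partial a (f \o chart_inv (A i)) (chart_map (A i) p).

(* The solution X of omega(X, .) = - df at p, i.e. X *m omega_i = - df. *)
Definition hamiltonian_vf (R : realType) (m : nat) (M : topologicalType)
    (A : smooth_atlas R m M) (omega : symplectic_form A) (f : M -> R)
    (i : atlas_index A) (p : M) : 'rV[R]_m :=
  - differential f i p *m invmx (omega i (chart_map (A i) p)).

(* {f, g} = omega(X_f, X_g); other conventions only change the sign. *)
Definition poisson_bracket (R : realType) (m : nat) (M : topologicalType)
    (A : smooth_atlas R m M) (omega : symplectic_form A) (f g : M -> R)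
    (p : M) : R :=
  let i := chart_at A p in
  tensor2_eval omega i p
    (hamiltonian_vf omega f i p) (hamiltonian_vf omega g i p).

Definition unif_norm (R : realType) (M : topologicalType) (f : M -> R) :
    \bar R :=
  ereal_sup [set (`|f p|)%:E | p in [set: M]].

Definition partition_of_unity (R : realType) (m : nat) (M : topologicalType)
    (A : smooth_atlas R m M) (I : finType) (f : I -> M -> R) : Prop :=
  [/\ forall i, smooth_fun A (f i),
      forall i p, 0 <= f i p
    & forall p, \sum_i f i p = 1].

Definition subordinate (R : realType) (M : topologicalType) (I : finType)
    (f : I -> M -> R) (U : I -> set M) : Prop :=
  forall i, closure [set p | f i p != 0] `<=` U i.

Definition unit_cube (R : realType) (I : finType) : set (I -> R) :=
  [set x | forall i, -1 <= x i <= 1].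

Definition lin_comb (R : realType) (M : topologicalType) (I : finType)
    (x : I -> R) (f : I -> M -> R) (p : M) : R :=
  \sum_i x i * f i p.

(* The maximum over the compact cube is written as a supremum. *)
Definition pb (R : realType) (m : nat) (M : topologicalType)
    (A : smooth_atlas R m M) (omega : symplectic_form A) (I : finType)
    (U : I -> set M) : \bar R :=
  ereal_inf
    [set ereal_sup
           [set unif_norm (poisson_bracket omega (lin_comb xy.1 f)
                                                 (lin_comb xy.2 f))
           | xy in @unit_cube R I `*` @unit_cube R I]
    | f in [set f | partition_of_unity A f /\ subordinate f U]].

Definition smooth_curve (R : realType) (m : nat) (M : topologicalType)
    (A : smooth_atlas R m M) (c : R -> M) : Prop :=
  continuous c /\
  forall i, smooth_on (c @^-1` chart_dom (A i)) (chart_map (A i) \o c).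

Definition speed (R : realType) (m : nat) (M : topologicalType)
    (A : smooth_atlas R m M) (rho : riemannian_metric A) (c : R -> M)
    (t : R) : R :=
  let i := chart_at A (c t) in
  let v := derive1 (chart_map (A i) \o c) t in
  Num.sqrt (tensor2_eval rho i (c t) v v).

Definition curve_length (R : realType) (m : nat) (M : topologicalType)
    (A : smooth_atlas R m M) (rho : riemannian_metric A) (c : R -> M) :
    \bar R :=
  (\int[lebesgue_measure]_(t in `[0%R, 1%R]) (speed rho c t)%:E)%E.

(* piecewise_smooth_path rho p q L: some piecewise smooth curve of length L
   joins p to q. Each piece is reparametrized by [0, 1] and extended to a
   smooth curve on the whole real line. *)
Inductive piecewise_smooth_path (R : realType) (m : nat) (M : topologicalType)
    (A : smooth_atlas R m M) (rho : riemannian_metric A) :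
    M -> M -> \bar R -> Prop :=
| path_const (p : M) : piecewise_smooth_path rho p p 0%E
| path_concat (c : R -> M) (q : M) (L : \bar R) :
    smooth_curve A c -> piecewise_smooth_path rho (c 1) q L ->
    piecewise_smooth_path rho (c 0) q (curve_length rho c + L)%E.

(* +oo between distinct connected components. *)
Definition riem_dist (R : realType) (m : nat) (M : topologicalType)
    (A : smooth_atlas R m M) (rho : riemannian_metric A) (p q : M) : \bar R :=
  ereal_inf [set L | piecewise_smooth_path rho p q L].

Definition riem_diam (R : realType) (m : nat) (M : topologicalType)
    (A : smooth_atlas R m M) (rho : riemannian_metric A) (U : set M) :
    \bar R :=
  ereal_sup [set riem_dist rho pq.1 pq.2 | pq in U `*` U].

Definition open_cover (M : topologicalType) (I : finType) (U : I -> set M) :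
    Prop :=
  (forall i, open (U i)) /\ \bigcup_i U i = [set: M].

(* Main.v *)
Require Import Defs.
From HB Require Import structures.
From mathcomp Require Import all_boot all_order all_algebra all_fingroup.
From mathcomp Require Import all_classical all_reals all_analysis.
From mathcomp Require Import ring lra zify.

Set Implicit Arguments.
Unset Strict Implicit.
Unset Printing Implicit Defensive.
Import Order.TTheory GRing.Theory Num.Theory numFieldNormedType.Exports.
Local Open Scope classical_set_scope.
Local Open Scope ring_scope.

(** If all brackets of combinations of the f_i are bounded by C, put
    Psi_b = sum_i H_b(p_i) f_i, where p_i is a point of U_i and H_b is the b-th
    coordinate of a chart, rescaled and truncated to [0, 1]. Constants commute
    with everything, so {Psi_b, Psi_c} at p only sees the oscillation of the
    coefficients over the U_i containing p, whence {Psi_b, Psi_c} = O(C eps^2).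
    The determinant of the matrix of brackets is det(d Psi)^2 / det omega, so
    det(d Psi) is uniformly small on a coordinate cube. But Psi_b is exactly 0
    and 1 on two opposite faces of the cube, so that the integral of det(d Psi)
    over the cube is 1 by Stokes' theorem: a contradiction. No rigidity result of
    symplectic topology is needed, and the bound is of order eps^-2.

    Stokes' theorem is replaced by an exact identity for finite differences on a
    grid, in which all operators are combinations of commuting translations. *)

(** * A discrete Stokes formula *)

(* The coefficient of the cup product of the discrete differentials of the F j,
   i.e. the Laplace expansion of the Jacobian determinant with partial
   derivatives replaced by differences; the shifts by [e i] come from the
   discrete Leibniz rule. *)
Fixpoint disc_jac (K : comNzRingType) (V : zmodType) (k : nat) :
    ('I_k -> V) -> ('I_k -> V -> K) -> V -> K :=
  match k with
  | 0%N => fun _ _ _ => 1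
  | k'.+1 => fun e F x => \sum_(i < k'.+1) (-1) ^+ i *
      (F ord0 (x + e i) - F ord0 x) *
      disc_jac (e \o lift i) (F \o lift ord0) (x + e i)
  end.

(** A pair [(i, j)] encodes the ordered pair of distinct indices [(i, lift i j)]. For [j < i] the
    swapped pair is encoded by [(inord j, inord i.-1)], so the terms cancel two by two. *)
Lemma sum_lift_antisym (K : zmodType) (k : nat) (g : 'I_k.+2 -> 'I_k.+1 -> K) :
  (forall (i : 'I_k.+2) (j : 'I_k.+1), (j < i)%N ->
     g (inord j) (inord i.-1) = - g i j) ->
  \sum_i \sum_j g i j = 0.
Proof.
move=> gN; rewrite pair_big /=.
rewrite (bigID (fun p : 'I_k.+2 * 'I_k.+1 => (p.2 < p.1)%N)) /=.
rewrite [X in _ + X](reindex_onto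
  (fun p : 'I_k.+2 * 'I_k.+1 => (inord p.2 : 'I_k.+2, inord p.1.-1 : 'I_k.+1))
  (fun p : 'I_k.+2 * 'I_k.+1 => (inord p.2.+1 : 'I_k.+2, inord p.1 : 'I_k.+1))) /=; last first.
  move=> [i j] /=; rewrite -leqNgt => ij; congr pair; apply/val_inj => /=.
    have := ltn_ord j; have := ltn_ord i => hi hj.
    by rewrite !inordK //; lia.
  have := ltn_ord j; have := ltn_ord i => hi hj.
  by rewrite !inordK //; lia.
rewrite [X in _ + X](eq_bigl (fun p : 'I_k.+2 * 'I_k.+1 => (p.2 < p.1)%N)); last first.
  move=> [i j] /=; have := ltn_ord j; have := ltn_ord i => hi hj.
  rewrite inordK; last lia.
  rewrite inordK; last lia.
  case: (ltnP j i) => ij.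
    apply/andP; split; first lia.
    apply/eqP; congr pair; apply/val_inj => /=; rewrite !inordK //; lia.
  apply/negbTE/negP => /andP[h /eqP[]] /(congr1 val)/=.
  rewrite !inordK; lia.
rewrite -big_split /= big1 // => -[i j] /= ij.
by rewrite gN // subrr.
Qed.

Section disc_jac_theory.
Variables (K : comNzRingType) (V : zmodType).
Implicit Types (k : nat) (x : V).

(** The two sides differ by [F ord0 x] times the sum in the hypothesis, the discrete differential of
    the product of the other factors. Its vanishing stays a hypothesis because the induction proving
    it uses this formula. *)
Lemma disc_jac_divergence_aux k (e : 'I_k.+1 -> V) (F : 'I_k.+1 -> V -> K) x :
  \sum_(i < k.+1) (-1) ^+ i * (disc_jac (e \o lift i) (F \o lift ord0) (x + e i) -
                      disc_jac (e \o lift i) (F \o lift ord0) x) = 0 ->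
  disc_jac e F x = \sum_(i < k.+1) (-1) ^+ i *
    (F ord0 (x + e i) * disc_jac (e \o lift i) (F \o lift ord0) (x + e i) -
     F ord0 x * disc_jac (e \o lift i) (F \o lift ord0) x).
Proof.
move=> h; apply/eqP; rewrite -subr_eq0 -oppr_eq0; apply/eqP.
rewrite -[RHS](mulr0 (F ord0 x)) -[in RHS]h mulr_sumr /= -sumrB -sumrN.
by apply: eq_bigr => i _; ring.
Qed.

(** The discrete form of d d = 0. The divergence formula in lower dimension gives second differences
    over ordered pairs of directions. They are symmetric, since translations commute and the
    remaining factor depends only on the unordered pair, while the signs of a pair and of its swap
    are opposite. *)
Lemma disc_jac_closed k (e : 'I_k.+1 -> V) (F : 'I_k -> V -> K) x :
  \sum_(i < k.+1) (-1) ^+ i * (disc_jac (e \o lift i) F (x + e i) -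
                      disc_jac (e \o lift i) F x) = 0.
Proof.
elim: k => [|k IH] in e F x *; first by rewrite big1 // => i _; rewrite /= subrr mulr0.
pose G (i : 'I_k.+2) (j : 'I_k.+1) z :=
  F ord0 z * disc_jac (e \o lift i \o lift j) (F \o lift ord0) z.
rewrite (eq_bigr (fun i : 'I_k.+2 => \sum_(j < k.+1) (-1) ^+ i * ((-1) ^+ j *
   (G i j (x + e i + e (lift i j)) - G i j (x + e i) -
    (G i j (x + e (lift i j)) - G i j x))))); last first.
  move=> i _.
  rewrite -mulr_sumr (disc_jac_divergence_aux (IH _ _ _)).
  rewrite (disc_jac_divergence_aux (IH _ _ _)) -sumrB.
  by congr (_ * _); apply: eq_bigr => j _; rewrite -mulrBr.
apply: sum_lift_antisym => i j ij.
have := ltn_ord j; have := ltn_ord i => hi hj.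
have E1 : lift i j = inord j :> 'I_k.+2.
  by apply/val_inj; rewrite /= /bump inordK; lia.
have E2 : lift (inord j : 'I_k.+2) (inord i.-1 : 'I_k.+1) = i.
  by apply/val_inj; rewrite /= /bump !inordK; lia.
have E3 : G (inord j) (inord i.-1) = G i j.
  apply/funext => z; rewrite /G; congr (_ * disc_jac _ _ _).
  apply/funext => l /=; congr e; apply/val_inj; rewrite /= /bump !inordK; lia.
rewrite E1 E2 E3 !inordK; [|lia..].
rewrite (addrAC x (e (inord j))).
have -> : (-1) ^+ i = - (-1) ^+ i.-1 :> K.
  by rewrite -{1}(ltn_predK ij) exprS mulN1r.
ring.
Qed.

Lemma disc_jac_divergence k (e : 'I_k.+1 -> V) (F : 'I_k.+1 -> V -> K) x :
  disc_jac e F x = \sum_(i < k.+1) (-1) ^+ i *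
    (F ord0 (x + e i) * disc_jac (e \o lift i) (F \o lift ord0) (x + e i) -
     F ord0 x * disc_jac (e \o lift i) (F \o lift ord0) x).
Proof. exact/disc_jac_divergence_aux/disc_jac_closed. Qed.

End disc_jac_theory.

(** * Summation over a grid and reduction to its faces *)

Section grid.
Variables (K : comNzRingType) (V : zmodType) (N : nat).

(** The points are the lower corners of the [N ^ k] cells; the far faces, at coordinate [N], are
    reached only by shifts. *)
Definition grid_sum (k : nat) (e : 'I_k -> V) (G : V -> K) (x : V) : K :=
  \sum_(t : {ffun 'I_k -> 'I_N}) G (x + \sum_i e i *+ t i).

Lemma grid_sum_lift k (e : 'I_k.+1 -> V) (i : 'I_k.+1) (G : V -> K) x :
  grid_sum e G x =
  grid_sum (e \o lift i) (fun y => \sum_(j < N) G (y + e i *+ j)) x.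
Proof.
pose glue (p : {ffun 'I_k -> 'I_N} * 'I_N) : {ffun 'I_k.+1 -> 'I_N} :=
  [ffun l => if unlift i l is Some l' then p.1 l' else p.2].
pose cut (t : {ffun 'I_k.+1 -> 'I_N}) : {ffun 'I_k -> 'I_N} * 'I_N :=
  ([ffun l => t (lift i l)], t i).
rewrite /grid_sum [RHS]pair_big /= (reindex glue); last first.
  apply: onW_bij; exists cut => [[t j]|t] /=.
    rewrite /cut /glue; congr pair; last by rewrite ffunE unlift_none.
    by apply/ffunP => l; rewrite !ffunE liftK.
  apply/ffunP => l; rewrite ffunE.
  by case: unliftP => [l' ->|->]; rewrite //= ffunE.
apply: eq_bigr => -[t j] _ /=; congr G.
rewrite (bigD1_ord i) //= ffunE unlift_none /= addrA addrAC; congr (_ + _ + _).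
by apply: eq_bigr => l _; rewrite ffunE liftK.
Qed.

Lemma grid_sum_diff k (e : 'I_k.+1 -> V) (i : 'I_k.+1) (G : V -> K) x :
  grid_sum e (fun y => G (y + e i) - G y) x =
  grid_sum (e \o lift i) G (x + e i *+ N) - grid_sum (e \o lift i) G x.
Proof.
rewrite (grid_sum_lift _ i) -sumrB; apply: eq_bigr => t _.
rewrite (eq_bigr (fun j : 'I_N => G (x + \sum_l (e \o lift i) l *+ t l + e i *+ j.+1)
   - G (x + \sum_l (e \o lift i) l *+ t l + e i *+ j))); last first.
  by move=> j _; rewrite mulrS -addrA (addrC (_ *+ _) (e i)).
rewrite -(big_mkord xpredT (fun j => G (_ + _ + e i *+ j.+1) - G (_ + _ + e i *+ j))).
rewrite (@telescope_sumr_eq _ _ _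
  (fun j => G (x + \sum_l (e \o lift i) l *+ t l + e i *+ j))) //.
by rewrite mulr0n addr0 addrAC.
Qed.

(** [disc_jac e F x] only reads [F] at the vertices of the unit cell at [x], and each of its terms
    contains a difference of [F j] along an edge of that cell. *)
Lemma disc_jac_const k (e : 'I_k -> V) (F : 'I_k -> V -> K) x (j : 'I_k) (c : K) :
  (forall t : 'I_k -> bool, F j (x + \sum_i e i *+ t i) = c) ->
  disc_jac e F x = 0.
Proof.
elim: k => [|k IH] in e F x j * => Fc; first by case: j Fc.
rewrite /= big1 // => i _; case: (unliftP ord0 j) => [j'|] jE.
  rewrite (IH _ _ _ j') ?mulr0 // => t /=; rewrite -jE.
  (* A vertex of the smaller cell at [x + e i] is a vertex of the original cell with coordinate
     [true] in direction [i]. *)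
  rewrite -(Fc (fun l => if unlift i l is Some l' then t l' else true)).
  rewrite (bigD1_ord i) //= unlift_none mulr1n addrA; congr (F j (_ + _)).
  by apply: eq_bigr => l _; rewrite liftK.
rewrite -jE.
have -> : F j (x + e i) = c.
  rewrite -(Fc (fun l => l == i)) (bigD1 i) //= eqxx mulr1n big1 ?addr0 //.
  by move=> l /negbTE ->.
have -> : F j x = c.
  by rewrite -(Fc (fun l => false)) big1 ?addr0 // => l _; rewrite mulr0n.
by rewrite subrr mulr0 mul0r.
Qed.

(* By the divergence form, summation leaves terms on the faces; those on the
   faces transverse to [e i], i != 0, vanish because [F i] is constant there. *)
Lemma grid_sum_disc_jac k (e : 'I_k -> V) (F : 'I_k -> V -> K) x :
  (forall (j : 'I_k) (t : 'I_k -> nat), (forall i, (t i <= N)%N) ->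
     (t j = 0%N -> F j (x + \sum_i e i *+ t i) = 0) /\
     (t j = N -> F j (x + \sum_i e i *+ t i) = 1)) ->
  grid_sum e (disc_jac e F) x = 1.
Proof.
elim: k => [|k IH] in e F x * => bdry.
  rewrite /grid_sum (eq_bigr (fun=> 1)) // sumr_const card_ffun !card_ord expn0.
  by rewrite mulr1n.
pose G i z := F ord0 z * disc_jac (e \o lift i) (F \o lift ord0) z.
have -> : grid_sum e (disc_jac e F) x = \sum_(i < k.+1) (-1) ^+ i *
    (grid_sum (e \o lift i) (G i) (x + e i *+ N) - grid_sum (e \o lift i) (G i) x).
  under [RHS]eq_bigr do rewrite -grid_sum_diff.
  transitivity (grid_sum e (fun z => \sum_(i < k.+1) (-1) ^+ i * (G i (z + e i) - G i z)) x).
    by apply: eq_bigr => t _; rewrite disc_jac_divergence.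
  rewrite /grid_sum.
  by rewrite exchange_big /=; apply: eq_bigr => i _; rewrite mulr_sumr.
have shiftE (i : 'I_k.+1) (a : nat) (t : 'I_k -> nat) :
    \sum_l e l *+ (if unlift i l is Some l' then t l' else a) =
    e i *+ a + \sum_l (e \o lift i) l *+ t l.
  rewrite (bigD1_ord i) //= unlift_none; congr (_ + _).
  by apply: eq_bigr => l _; rewrite liftK.
have face (i : 'I_k.+1) (a : nat) (t : 'I_k -> nat) : (a <= N)%N ->
    (forall l, (t l <= N)%N) ->
    (a = 0%N -> F i (x + (e i *+ a + \sum_l (e \o lift i) l *+ t l)) = 0) /\
    (a = N -> F i (x + (e i *+ a + \sum_l (e \o lift i) l *+ t l)) = 1).
  move=> aN tN; rewrite -shiftE.
  have [|h0 hN] := bdry i (fun l => if unlift i l is Some l' then t l' else a).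
    by move=> l; case: unliftP => [l' _|_].
  by move: h0 hN; rewrite unlift_none.
(* On a face transverse to a direction other than [e ord0], the corner [t] and the offset [b] inside
   the cell add up to coordinates at most [N]. The function of that direction is therefore constant,
   0 or 1, on each cell of the face. *)
have side (i : 'I_k) (a : nat) : a = 0%N \/ a = N ->
    grid_sum (e \o lift (lift ord0 i)) (G (lift ord0 i)) (x + e (lift ord0 i) *+ a) = 0.
  move=> a0N; rewrite /grid_sum big1 // => t _.
  rewrite /G (@disc_jac_const _ _ _ _ i (if a == 0%N then 0 else 1)) ?mulr0 // => b /=.
  have aN : (a <= N)%N by case: a0N => ->.
  have [|h0 hN] := @face (lift ord0 i) a (fun l => t l + b l)%N aN.
    by move=> l; have := ltn_ord (t l); case: (b l); lia.
  rewrite -!addrA -big_split /=.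
  rewrite (eq_bigr (fun l => (e \o lift (lift ord0 i)) l *+ (t l + b l)));
    last by move=> l _; rewrite mulrnDr.
  by case: eqP => [/h0//|]; case: a0N => // /hN.
rewrite big_ord_recl /= big1 ?addr0 => [|i _]; last first.
  rewrite side; last by right.
  have := side i 0%N (or_introl erefl); rewrite mulr0n addr0 => ->.
  by rewrite subrr mulr0.
rewrite mul1r [X in _ - X]big1 ?subr0 => [|t _]; last first.
  have [|h0 _] := @face ord0 0%N (fun l => t l) isT.
    by move=> l; apply: ltnW.
  by rewrite /G; move: h0; rewrite mulr0n add0r => ->; rewrite ?mul0r.
(* On the far face transverse to [e ord0] the factor [F ord0] is 1, which leaves the same sum in one
   dimension less. *)
rewrite -[RHS](IH (e \o lift ord0) (F \o lift ord0) (x + e ord0 *+ N)).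
  apply: eq_bigr => t _; rewrite /G.
  have [|_ hN] := @face ord0 N (fun l => t l) (leqnn N).
    by move=> l; apply: ltnW.
  by rewrite -addrA hN ?mul1r // addrA.
move=> j t tN; rewrite -addrA -shiftE.
have [|h0 hN] := bdry (lift ord0 j) (fun l => if unlift ord0 l is Some l' then t l' else N).
  by move=> l; case: unliftP => [l' _|_].
by move: h0 hN; rewrite liftK.
Qed.

End grid.

(** * Comparison of the discrete Jacobian with a determinant *)

Section disc_jac_approx.
Variable R : realType.

Lemma norm_det_le (k : nat) (A : 'M[R]_k) (B : R) :
  (forall i j, `|A i j| <= B) -> `|\det A| <= k`!%:R * B ^+ k.
Proof.
move=> AB; apply: le_trans (ler_norm_sum _ _ _) _.
rewrite -card_Sn -sum1_card natr_sum mulr_suml; apply: ler_sum => /= s _.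
rewrite normrM normrX normrN1 expr1n !mul1r normr_prod.
rewrite -[in leRHS](card_ord k) -prodr_const.
by apply: ler_prod => i _; rewrite normr_ge0 AB.
Qed.

(** Induction on the expansion along the first column, which [disc_jac] imitates. The hypothesis
    concerns the differences along the edges of the unit cell. The constant depends only on [k] and
    [B], so that [eta] and the mesh can be chosen after it. *)
Lemma disc_jac_approx (V : zmodType) (k : nat) (B : R) : 0 <= B ->
  exists2 C : R, 0 <= C &
  forall (e : 'I_k -> V) (F : 'I_k -> V -> R) (x : V) (A : 'M[R]_k) (h eta : R),
    0 <= h -> 0 <= eta <= 1 -> (forall i j, `|A i j| <= B) ->
    (forall i j (t : 'I_k -> bool), ~~ t i ->
      `|F j (x + \sum_l e l *+ t l + e i) - F j (x + \sum_l e l *+ t l) -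
        h * A i j| <= h * eta) ->
    `|disc_jac e F x - h ^+ k * \det A| <= C * eta * h ^+ k.
Proof.
move=> B0; elim: k => [|k [C C0 IH]].
  exists 0 => // e F x A h eta *; rewrite det_mx00 expr0 !mulr1.
  by rewrite [disc_jac _ _ _]/(1 : R) subrr normr0 !mul0r.
pose d : R := k`!%:R * B ^+ k.
have d0 : 0 <= d by rewrite mulr_ge0 ?exprn_ge0.
exists (k.+1%:R * ((B + 1) * C + d)).
  by rewrite mulr_ge0 // addr_ge0 // mulr_ge0 // addr_ge0.
move=> e F x A h eta h0 /andP[eta0 eta1] AB FA.
rewrite (expand_det_col A ord0) /= mulr_sumr -sumrB.
apply: le_trans (ler_norm_sum _ _ _) _.
have -> : k.+1%:R * ((B + 1) * C + d) * eta * h ^+ k.+1 =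
   \sum_(i < k.+1) ((B + 1) * C + d) * eta * h ^+ k.+1.
  by rewrite sumr_const card_ord -[RHS]mulr_natl !mulrA.
apply: ler_sum => i _.
rewrite /cofactor addn0; set D := F ord0 _ - _.
set E := disc_jac _ _ _; set M := \det _.
(* The error of the product splits into the error of the minor and that of the increment; [eta <= 1]
   will bound the increment by [h * (B + 1)]. *)
have -> : (-1) ^+ i * D * E - h ^+ k.+1 * (A i ord0 * ((-1) ^+ i * M)) =
  (-1) ^+ i * (D * (E - h ^+ k * M) + (D - h * A i ord0) * (h ^+ k * M)).
  by rewrite exprS; ring.
rewrite normrM normrX normrN1 expr1n mul1r.
have hD : `|D - h * A i ord0| <= h * eta.
  have := FA i ord0 (fun=> false) isT.
  by rewrite (eq_bigr (fun=> 0)) ?sumr_const ?mul0rn ?addr0.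
have hM : `|M| <= d by apply: norm_det_le => a b; rewrite !mxE AB.
have hE : `|E - h ^+ k * M| <= C * eta * h ^+ k.
  apply: IH => // [|a b|a b t ta]; first by rewrite eta0.
    by rewrite !mxE.
  rewrite !mxE.
  have := FA (lift i a) (lift ord0 b)
    (fun l => if unlift i l is Some l' then t l' else true).
  rewrite liftK => /(_ ta); congr (_ <= _).
  rewrite (bigD1_ord i) //= unlift_none mulr1n addrA.
  by rewrite (eq_bigr (fun l => (e \o lift i) l *+ t l)) // => l _; rewrite liftK.
have hDB : `|D| <= h * (B + 1).
  rewrite -[D](subrK (h * A i ord0)).
  apply: le_trans (ler_normD _ _) _; rewrite mulrDr mulr1 addrC lerD //.
    by rewrite normrM (ger0_norm h0) ler_wpM2l.
  by apply: le_trans hD _; rewrite ler_piMr.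
apply: le_trans (ler_normD _ _) _; rewrite !normrM (ger0_norm (exprn_ge0 _ h0)).
have -> : ((B + 1) * C + d) * eta * h ^+ k.+1 =
   (h * (B + 1)) * (C * eta * h ^+ k) + (h * eta) * (h ^+ k * d).
  by rewrite exprS; ring.
rewrite lerD // ler_pM // ?mulr_ge0 ?exprn_ge0 //.
by rewrite ler_wpM2l ?exprn_ge0.
Qed.

End disc_jac_approx.

(** * Maps of a cube preserving the faces *)

Section degree.
Variable R : realType.

(** Continuity at the points of [Q] is meant in the whole space, so [y] may leave [Q]. *)
Lemma compact_unif_continuous (V W : normedModType R) (Q : set V) (f : V -> W) :
  compact Q -> (forall x, Q x -> {for x, continuous f}) ->
  forall eta : R, 0 < eta -> \forall delta \near 0^'+,
    forall x y, Q x -> `|x - y| < delta -> `|f x - f y| <= eta.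
Proof.
move=> /compact_near_coveringP cQ fc eta eta0.
suff : \forall d \near 0^'+, Q `<=` [set x | forall y, `|x - y| < d -> `|f x - f y| <= eta].
  by apply: filterS => d hd x y Qx; exact: hd.
apply: cQ => x Qx.
have eta20 : 0 < eta / 2 by rewrite divr_gt0.
have /cvgrPdist_lt/(_ _ eta20) /nbhs_ballP [d /= d0 xd] := fc x Qx.
have d20 : 0 < d / 2 by rewrite divr_gt0.
exists (ball x (d / 2), [set e | e < d / 2]) => /=.
  by split; [exact: nbhsx_ballx | exact: nbhs_right_lt].
move=> [x' e] [/= xx' ed] y x'y.
have fx' : `|f x - f x'| < eta / 2.
  by apply: xd; apply: le_ball xx'; rewrite ler_pdivrMr // ler_pMr // ler1n.
have fy : `|f x - f y| < eta / 2.
  apply: xd; move: xx'; rewrite -!ball_normE /= => xx'.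
  rewrite -(subrKA x') [d]splitr (le_lt_trans (ler_normD _ _)) // ltrD //.
  exact: lt_trans ed.
rewrite -(subrKA (f x)) (le_trans (ler_normD _ _)) // [eta]splitr lerD // ltW //.
by rewrite distrC.
Qed.

Lemma compact_norm_bounded (V W : normedModType R) (Q : set V) (f : V -> W) :
  compact Q -> (forall x, Q x -> {for x, continuous f}) ->
  \forall B \near +oo, forall x, Q x -> `|f x| <= B.
Proof.
move=> /compact_near_coveringP cQ fc.
apply: (cQ _ +oo (fun B x => `|f x| <= B)) => x Qx.
have /cvgrPdist_lt/(_ _ ltr01) fx := fc x Qx.
exists ([set y | `|f x - f y| < 1], [set B | `|f x| + 1 <= B]) => /=.
  by split; [exact: fx | exact: nbhs_pinfty_ge].
move=> [y B] [/= fxy]; apply: le_trans.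
rewrite -[f y](subrK (f x)) (le_trans (ler_normD _ _)) // addrC lerD2l distrC.
exact: ltW.
Qed.

Lemma rV_norm_leP (m : nat) (x : 'rV[R]_m) (c : R) : 0 <= c ->
  `|x| <= c <-> forall i, `|x 0 i| <= c.
Proof.
move=> c0; rewrite [`|x|]/Num.Def.normr /= mx_normrE; split=> [xc i|xc].
  by apply: le_trans xc; exact: (@le_bigmax _ _ _ _ (fun ij => `|x ij.1 ij.2|) (0, i)).
by apply: bigmax_le => // -[j i] _ /=; rewrite ord1.
Qed.

Lemma compact_cube (m : nat) (y0 : 'rV[R]_m) (s : R) :
  compact [set y : 'rV[R]_m | `|y - y0| <= s].
Proof.
apply: bounded_closed_compact.
  exists (`|y0| + s); split; first exact: num_real.
  move=> x xs y /= ys; rewrite -[y](subrK y0) (le_trans (ler_normD _ _)) //.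
  by rewrite addrC (le_trans _ (ltW xs)) // lerD2l.
apply: (closed_comp (f := fun y : 'rV[R]_m => `|y - y0|) (D := [set z | z <= s])).
  move=> y _; apply: (@cvg_norm _ _ _ (nbhs y) _ (fun z => z - y0)).
  by apply: cvgB; [exact: cvg_id | exact: cvg_cst].
exact: closed_le.
Qed.

Lemma partial_MVT (m : nat) (F : 'rV[R]_m -> R) (a : 'I_m) (y : 'rV[R]_m) (h : R) :
  0 <= h ->
  (forall t, 0 <= t <= h -> differentiable F (y + t *: delta_mx 0 a)) ->
  exists2 t, 0 <= t <= h &
    F (y + h *: delta_mx 0 a) - F y = h * partial a F (y + t *: delta_mx 0 a).
Proof.
move=> h0 dF; pose f t := F (y + t *: delta_mx 0 a).
have quot t : (fun s : R => s^-1 *: (f (s *: 1 + t) - f t)) =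
    (fun s : R => s^-1 *: (F (s *: delta_mx 0 a + (y + t *: delta_mx 0 a)) -
                           F (y + t *: delta_mx 0 a))).
  apply/funext => s; rewrite /f; congr (_ *: (F _ - _)).
  by rewrite (mulr1 s : s *: (1 : R) = s) scalerDl addrCA.
have fd t : 0 <= t <= h -> is_derive t 1 f (partial a F (y + t *: delta_mx 0 a)).
  move=> /dF/(@diff_derivable _ _ _ _ _ (delta_mx 0 a)) d.
  apply: DeriveDef; first by rewrite /derivable /= quot.
  by rewrite /partial /derive /= quot.
have [t||t th] := @MVT_segment R f
  (fun t => partial a F (y + t *: delta_mx 0 a)) 0 h h0.
- by rewrite in_itv /= => /andP[t0 th]; apply: fd; rewrite !ltW.
- apply: derivable_within_continuous => t; rewrite in_itv /= => /fd ft.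
  exact: ex_derive.
by rewrite /f scale0r addr0 subr0 mulrC => E; exists t => //; rewrite in_itv /= in th.
Qed.

(** Rows index directions and columns index functions, as for [jacobian] and in
    [disc_jac_approx]. *)
Definition jac (m : nat) (F : 'I_m -> 'rV[R]_m -> R) (y : 'rV[R]_m) : 'M[R]_m :=
  \matrix_(a, b) partial a (F b) y.

Lemma grid_point (m N : nat) (y0 : 'rV[R]_m) (s : R) (t : 'I_m -> nat) (i : 'I_m) :
  (y0 - const_mx s + \sum_l ((2 * s / N.+1%:R) *: delta_mx 0 l) *+ t l) 0 i =
  y0 0 i - s + 2 * s * ((t i)%:R / N.+1%:R).
Proof.
rewrite !mxE summxE (bigD1 i) //= big1 => [|l /negbTE li]; last first.
  by rewrite mulmxnE !mxE eqxx eq_sym li mulr0 mul0rn.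
rewrite mulmxnE !mxE !eqxx mulr1 addr0 -[_ *+ t i]mulr_natr mulrAC.
by rewrite -[_ / _ in LHS]mulrA.
Qed.

(** In the sup norm the ball is a cube of side [2 * s]. Were the determinant smaller throughout,
    each of the [N.+1 ^ m] cells of a fine grid would contribute at most [1 / 2 + 1 / 4] of its
    share [N.+1%:R ^- m] to a sum equal to 1. *)
Lemma jac_det_lb (m : nat) (F : 'I_m -> 'rV[R]_m -> R) (y0 : 'rV[R]_m) (s : R) :
  0 < s ->
  (forall b y, `|y - y0| <= s -> differentiable (F b) y) ->
  (forall a b y, `|y - y0| <= s -> {for y, continuous (partial a (F b))}) ->
  (forall b y, `|y - y0| <= s ->
     (y 0 b = y0 0 b - s -> F b y = 0) /\ (y 0 b = y0 0 b + s -> F b y = 1)) ->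
  exists2 y, `|y - y0| <= s & 1 / 2 <= (2 * s) ^+ m * `|\det (jac F y)|.
Proof.
move=> s0 dF cF bdry; set Q := [set y | `|y - y0| <= s].
have cQ : compact Q by exact: compact_cube.
apply: contrapT => noy.
have {}noy y : Q y -> (2 * s) ^+ m * `|\det (jac F y)| <= 1 / 2.
  by move=> Qy; rewrite leNgt; apply/negP => /ltW h; apply: noy; exists y.
pose pF (ab : 'I_m * 'I_m) := partial ab.1 (F ab.2).
have [B [B0 HB]] : exists B, 0 <= B /\ forall ab y, Q y -> `|pF ab y| <= B.
  have hB : \forall B \near +oo, forall ab : 'I_m * 'I_m, forall y, Q y -> `|pF ab y| <= B.
    apply: filter_forall => ab.
    by apply: compact_norm_bounded => // y Qy; exact: cF.
  by have [B [/= ? ?]] := filter_ex (filterI (nbhs_pinfty_ge (num_real 0)) hB); exists B.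
have [C C0 HC] := disc_jac_approx 'rV[R]_m m B0.
have sm0 : 0 <= (2 * s) ^+ m by rewrite exprn_ge0 // mulr_ge0 // ltW.
have D0 : 0 < 4 * (C * (2 * s) ^+ m + 1).
  by rewrite mulr_gt0 // ltr_wpDl // mulr_ge0.
(* Keeps the total error over all cells below [1 / 4]; the minimum with 1 is there for
   [disc_jac_approx]. *)
pose eta := Num.min 1 (4 * (C * (2 * s) ^+ m + 1))^-1.
have eta0 : 0 < eta by rewrite /eta lt_min ltr01 invr_gt0.
have etaC : C * eta * (2 * s) ^+ m <= 4^-1.
  rewrite mulrAC (@le_trans _ _ (C * (2 * s) ^+ m * (4 * (C * (2 * s) ^+ m + 1))^-1)) //.
    by rewrite ler_wpM2l ?mulr_ge0 // /eta ge_min lexx orbT.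
  rewrite ler_pdivrMr // mulrA mulVf // mul1r lerDl //.
have [N HN] : exists N : nat, forall ab x y, Q x -> `|x - y| <= 2 * s / N.+1%:R ->
    `|pF ab x - pF ab y| <= eta.
  have hd : \forall d \near 0^'+, forall ab : 'I_m * 'I_m,
      forall x y, Q x -> `|x - y| < d -> `|pF ab x - pF ab y| <= eta.
    apply: filter_forall => ab.
    by apply: compact_unif_continuous => // y Qy; exact: cF.
  have [d [/= d0 {}hd]] := filter_ex (filterI (nbhs_right_gt 0) hd).
  have d20 : 0 < d / (2 * s) by rewrite divr_gt0 // mulr_gt0.
  have [N _ /(_ N (leqnn N)) hN] := near_infty_natSinv_lt (PosNum d20).
  exists N => ab x y Qx xy; apply: hd => //; apply: le_lt_trans xy _.
  by rewrite mulrC -ltr_pdivlMr // mulr_gt0.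
pose h := 2 * s / N.+1%:R.
have h0 : 0 < h by rewrite divr_gt0 // mulr_gt0.
pose e (i : 'I_m) : 'rV[R]_m := h *: delta_mx 0 i.
pose g (t : 'I_m -> nat) := y0 - const_mx s + \sum_l e l *+ t l.
have gE t i : g t 0 i = y0 0 i - s + 2 * s * ((t i)%:R / N.+1%:R).
  exact: grid_point.
have addE (v w : 'rV[R]_m) r i l :
    (v + r *: delta_mx 0 i - w) 0 l = v 0 l + r * (l == i)%:R - w 0 l.
  by rewrite !mxE eqxx.
have gQ t r i : (forall l, (t l <= N.+1)%N) -> 0 <= r <= h -> (t i <= N)%N ->
    Q (g t + r *: delta_mx 0 i).
  move=> tN /andP[r0 rh] tiN; apply/rV_norm_leP; first exact: ltW.
  move=> l; rewrite addE gE.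
  have u0 : 0 <= (t l)%:R / N.+1%:R :> R by rewrite divr_ge0.
  have [->{l u0}|li] := eqVneq l i.
    have u0 : 0 <= (t i)%:R / N.+1%:R :> R by rewrite divr_ge0.
    have u1 : (t i)%:R / N.+1%:R + N.+1%:R^-1 <= 1 :> R.
      rewrite -[X in _ + X]mul1r -mulrDl -natr1 ler_pdivrMr ?ltr_wpDl //.
      by rewrite mul1r lerD2r ler_nat.
    rewrite /h in rh; move: u0 u1 rh; set u := _ / _; set v := _^-1 => u0 u1 rh.
    have := ler_wpM2l (ltW s0) u1; have := mulr_ge0 (ltW s0) u0.
    rewrite mulr1 ler_norml => p q.
    rewrite (mulr1 r : r * true%:R = r); apply/andP; split; lra.
  have u1 : (t l)%:R / N.+1%:R <= 1 :> R.
    by rewrite ler_pdivrMr // mul1r ler_nat tN.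
  move: u0 u1; set u := _ / _ => u0 u1.
  have := ler_wpM2l (ltW s0) u1; have := mulr_ge0 (ltW s0) u0.
  rewrite (mulr0 r : r * false%:R = 0) ler_norml => p q; apply/andP; split; lra.
have g_Q t : (forall l, (t l <= N.+1)%N) -> Q (g t).
  move=> tN; apply/rV_norm_leP; first exact: ltW.
  move=> l; have := addE (g t) y0 0 l l.
  rewrite scale0r addr0 mul0r addr0 gE => ->.
  have u0 : 0 <= (t l)%:R / N.+1%:R :> R by rewrite divr_ge0.
  have u1 : (t l)%:R / N.+1%:R <= 1 :> R.
    by rewrite ler_pdivrMr // mul1r ler_nat tN.
  move: u0 u1; set u := _ / _ => u0 u1.
  have := ler_wpM2l (ltW s0) u1; have := mulr_ge0 (ltW s0) u0.
  rewrite ler_norml => p q; apply/andP; split; lra.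
have bd := @grid_sum_disc_jac R 'rV[R]_m N.+1 m e F (y0 - const_mx s).
have /bd sum1 : forall (j : 'I_m) (t : 'I_m -> nat), (forall i, (t i <= N.+1)%N) ->
     (t j = 0%N -> F j (g t) = 0) /\ (t j = N.+1 -> F j (g t) = 1).
  move=> j t tN; have [h1 h2] := bdry j _ (g_Q t tN); split=> tj.
    by apply: h1; rewrite gE tj mul0r mulr0 addr0.
  by apply: h2; rewrite gE tj divff // mulr1; ring.
have cell (k : {ffun 'I_m -> 'I_N.+1}) :
    `|disc_jac e F (g (fun i => k i))| <= N.+1%:R ^- m * (3 / 4).
  set x := g _; pose A := jac F x.
  have xQ : Q x by apply: g_Q => l; exact: ltnW.
  have hE : h ^+ m = N.+1%:R ^- m * (2 * s) ^+ m.
    by rewrite /h expr_div_n mulrC.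
  have := HC e F x A h eta (ltW h0) _ _ _.
  rewrite ltW //= {1}/eta ge_min lexx /= => /(_ isT) hC.
  have {hC} : `|disc_jac e F x - h ^+ m * \det A| <= C * eta * h ^+ m.
    apply: hC => [i j|i j t ti]; first by rewrite mxE; exact: (HB (i, j)).
    have xtE : x + \sum_l e l *+ t l = g (fun l => k l + t l)%N.
      rewrite /x /g -addrA -big_split /=; congr (_ + _).
      by apply: eq_bigr => l _; rewrite mulrnDr.
    have tN l : (k l + t l <= N.+1)%N by have := ltn_ord (k l); case: (t l); lia.
    have tiN : (k i + t i <= N)%N.
      by rewrite (negbTE ti) addn0 -ltnS ltn_ord.
    rewrite xtE /e.
    have [|r rh ->] := @partial_MVT m (F j) i (g (fun l => k l + t l)%N) h (ltW h0).
      by move=> r rh; apply: dF; exact: gQ.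
    rewrite mxE -mulrBr normrM gtr0_norm // ler_pM2l // distrC.
    apply: (HN (i, j)) => //.
    (* The intermediate point lies on an edge of the cell with corner [x], hence within [h] of [x]
       in the sup norm. *)
    rewrite -/h; apply/rV_norm_leP; first exact: ltW.
    move=> l; rewrite -opprB [X in `|X|]mxE normrN addE /x !gE natrD.
    case/andP: rh => r0 rh; set a := y0 0 l - s.
    have [li|li] := eqVneq l i.
      have -> : (t l)%:R = 0 :> R by rewrite li (negbTE ti).
      rewrite addr0 (mulr1 r : r * true%:R = r).
      by rewrite addrAC subrr add0r ger0_norm.
    rewrite (mulr0 r : r * false%:R = 0) addr0 [(_ + _) / _]mulrDl.
    rewrite [_ * (_ + _)]mulrDr addrA [X in `|X|]addrC addKr mulrCA.
    rewrite (ger0_norm (mulr_ge0 _ (ltW h0))) // ler_piMl //; first exact: ltW.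
    by case: (t l).
  move=> hC; rewrite -[disc_jac _ _ _](subrK (h ^+ m * \det A)).
  apply: le_trans (ler_normD _ _) _.
  rewrite normrM (gtr0_norm (exprn_gt0 _ h0)) hE.
  have /= := noy _ xQ; rewrite -/A; move: hC; rewrite hE.
  set w := N.+1%:R ^- m; have w0 : 0 < w by rewrite /w invr_gt0 exprn_gt0.
  move=> h1 h2; have h3 : w * (C * eta * (2 * s) ^+ m) <= w * 4^-1 by rewrite ler_pM2l.
  have h4 : w * ((2 * s) ^+ m * `|\det A|) <= w * (1 / 2) by rewrite ler_pM2l.
  lra.
have : 1 <= \sum_(k : {ffun 'I_m -> 'I_N.+1}) N.+1%:R ^- m * (3 / 4) :> R.
  rewrite -[leLHS]sum1 (le_trans (ler_norm _)) // (le_trans (ler_norm_sum _ _ _)) //.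
  by apply: ler_sum => k _; exact: cell.
rewrite sumr_const card_ffun !card_ord -[X in _ <= X]mulr_natl mulrA natrX divff; last first.
  by rewrite expf_neq0.
lra.
Qed.

End degree.

(** * Riemannian distance in a chart *)

Section charts.
Variables (R : realType) (m : nat) (M : topologicalType) (A : smooth_atlas R m M).
Implicit Types (i j : atlas_index A) (p : M).

Lemma chart_mapK_at i p : chart_dom (A i) p -> chart_inv (A i) (chart_map (A i) p) = p.
Proof. by move=> ip; apply: chart_mapK; rewrite inE. Qed.

Lemma chart_img_map i p : chart_dom (A i) p -> chart_img (A i) (chart_map (A i) p).
Proof. by move=> ip; exists p. Qed.

Lemma chart_invK i y : chart_img (A i) y -> chart_map (A i) (chart_inv (A i) y) = y.
Proof. by case=> p ip <-; rewrite chart_mapK_at. Qed.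

Lemma chart_dom_inv i y : chart_img (A i) y -> chart_dom (A i) (chart_inv (A i) y).
Proof. by case=> p ip <-; rewrite chart_mapK_at. Qed.

Lemma differentiable_transition i j p :
  chart_dom (A i) p -> chart_dom (A j) p ->
  differentiable (transition (A i) (A j)) (chart_map (A i) p).
Proof.
by move=> ip jp; apply: (atlas_compat i j 1%N).1; exists p.
Qed.

Lemma derive1_chart (c : R -> M) i j (t : R) : smooth_curve A c ->
  chart_dom (A i) (c t) -> chart_dom (A j) (c t) ->
  derive1 (chart_map (A j) \o c) t =
  derive1 (chart_map (A i) \o c) t *m
    jacobian (transition (A i) (A j)) (chart_map (A i) (c t)).
Proof.
move=> [cc cs] it jt.
have dc : differentiable (chart_map (A i) \o c) t by exact: (cs i 1%N).1.
have dT := differentiable_transition it jt.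
rewrite !derive1E.
have -> : 'D_1 (chart_map (A j) \o c) t =
          'D_1 (transition (A i) (A j) \o (chart_map (A i) \o c)) t.
  apply: near_eq_derive.
  have : \forall s \near t, chart_dom (A i) (c s).
    by apply: (cc t); apply: open_nbhs_nbhs; split=> //; exact: chart_dom_open.
  apply: filterS => s si.
  by rewrite /transition /= chart_mapK_at.
rewrite deriveE; last exact: differentiable_comp.
rewrite diff_comp //= deriveE // /jacobian mul_rV_lin1.
by [].
Qed.

Lemma tensor2_eval_chart (T : tensor2 A) i j p (u v : 'rV[R]_m) :
  chart_dom (A i) p -> chart_dom (A j) p ->
  let J := jacobian (transition (A i) (A j)) (chart_map (A i) p) in
  tensor2_eval T i p u v = tensor2_eval T j p (u *m J) (v *m J).
Proof.
move=> ip jp J; rewrite /tensor2_eval (tensor2_compat T ip jp) -/J.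
by rewrite trmx_mul !mulmxA.
Qed.

Lemma speed_chart (rho : riemannian_metric A) (c : R -> M) i (t : R) :
  smooth_curve A c -> chart_dom (A i) (c t) ->
  speed rho c t = let v := derive1 (chart_map (A i) \o c) t in
                  Num.sqrt (tensor2_eval rho i (c t) v v).
Proof.
move=> cs it; rewrite /speed /=.
have jt : chart_dom (A (chart_at A (c t))) (c t) by rewrite /chart_at; case: cid.
by rewrite [in RHS](tensor2_eval_chart _ _ _ it jt) -derive1_chart.
Qed.

Lemma compact_pos_lb (T : topologicalType) (K : set T) (f : T -> R) :
  compact K -> (forall x, K x -> {for x, continuous f}) ->
  (forall x, K x -> 0 < f x) -> exists2 k : R, 0 < k & forall x, K x -> k <= f x.
Proof.
move=> /compact_near_coveringP cK fc f0.
have : \forall k \near 0^'+, K `<=` [set x | k <= f x].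
  apply: cK => x Kx; have fx2 : 0 < f x / 2 by rewrite divr_gt0 // f0.
  have /cvgrPdist_lt/(_ _ fx2) fx := fc x Kx.
  exists ([set y | `|f x - f y| < f x / 2], [set k | k < f x / 2]) => /=.
    by split; [exact: fx | exact: nbhs_right_lt].
  move=> [y k] [/= + kf]; rewrite ltr_norml => /andP[_ h].
  by move: h kf; lra.
move=> /(filterI (nbhs_right_gt 0)) /filter_ex [k [/= k0 hk]].
by exists k.
Qed.

Lemma compact_sphere : compact [set v : 'rV[R]_m | `|v| = 1].
Proof.
apply: subclosed_compact (@compact_cube R m 0 1) _.
  apply: (closed_comp (f := fun v : 'rV[R]_m => `|v|) (D := [set z | z = 1])).
    by move=> v _; exact: norm_continuous.
  exact: closed_eq.
by move=> v v1; rewrite /= subr0 (v1 : `|v| = 1).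
Qed.

Lemma cvg_sumr (T : Type) (F : set_system T) (I : finType) (f : I -> T -> R) (l : I -> R) :
  Filter F -> (forall a, f a x @[x --> F] --> l a) ->
  \sum_a f a x @[x --> F] --> \sum_a l a.
Proof. by move=> FF fl; apply: cvg_big => //; exact: add_continuous. Qed.

(** By homogeneity vectors of norm 1 suffice, and a positive continuous function is bounded below on
    the compact product of [Q] with the unit sphere. *)
Lemma metric_lb (rho : riemannian_metric A) i (Q : set 'rV[R]_m) :
  compact Q -> Q `<=` chart_img (A i) ->
  exists2 k : R, 0 < k & forall p (v : 'rV[R]_m),
    chart_dom (A i) p -> Q (chart_map (A i) p) ->
    k * `|v| <= Num.sqrt (tensor2_eval rho i p v v).
Proof.
move=> cQ Qi.
pose q (x : 'rV[R]_m * 'rV[R]_m) := \sum_b (\sum_a x.2 0 a * rho i x.1 a b) * x.2 0 b.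
have qE p v : tensor2_eval rho i p v v = q (chart_map (A i) p, v).
  rewrite /tensor2_eval mxE; apply: eq_bigr => b _.
  by rewrite !mxE.
have qc x : Q x.1 -> {for x, continuous q}.
  move=> Qx; have rc : {for x.1, continuous (rho i)}.
    by apply: (tensor2_smooth rho i 0%N); exact: Qi.
  have c2 a : {for x, continuous (fun x : 'rV[R]_m * 'rV[R]_m => x.2 0 a)}.
    apply: (@continuous_comp _ _ _ snd (fun v : 'rV[R]_m => v 0 a) x).
      exact: cvg_snd.
    exact: coord_continuous.
  have cr a b : {for x, continuous (fun x : 'rV[R]_m * 'rV[R]_m => rho i x.1 a b)}.
    apply: (@continuous_comp _ _ _ (fun x : 'rV[R]_m * 'rV[R]_m => rho i x.1)
              (fun N : 'M[R]_m => N a b) x); last exact: coord_continuous.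
    by apply: (@continuous_comp _ _ _ fst (rho i) x) => //; exact: cvg_fst.
  apply: cvg_sumr => b; apply: cvgM; last exact: c2.
  by apply: cvg_sumr => a; apply: cvgM; [exact: c2 | exact: cr].
have [k k0 hk] : exists2 k : R, 0 < k &
    forall x, (Q `*` [set v : 'rV[R]_m | `|v| = 1]) x -> k <= q x.
  apply: compact_pos_lb => [|x [Qx _]|[y v] [/= Qy v1]].
  - by apply: compact_setX => //; exact: compact_sphere.
  - exact: qc.
  - have [p ip py] := Qi y Qy; rewrite -py -qE; apply: rmetric_posdef => //.
    by rewrite -normr_eq0 v1 oner_eq0.
exists (Num.sqrt k); first by rewrite sqrtr_gt0.
move=> p v ip Qp; have [->|v0] := eqVneq v 0; first by rewrite normr0 mulr0 sqrtr_ge0.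
have nv : 0 < `|v| by rewrite normr_gt0.
rewrite -[`|v|]ger0_norm // -sqrtr_sqr -sqrtrM; last exact: ltW.
rewrite ler_sqrt.
  have := hk (chart_map (A i) p, `|v|^-1 *: v).
  have -> : q (chart_map (A i) p, `|v|^-1 *: v) = `|v| ^- 2 * tensor2_eval rho i p v v.
    rewrite -qE /tensor2_eval -scalemxAl linearZ /= -scalemxAl -scalemxAr scalerA.
    by rewrite mxE -invfM expr2.
  rewrite ler_pdivlMl ?exprn_gt0 // mulrC; apply; split=> //=.
  by rewrite normrZ normfV normr_id mulVf // gt_eqF.
exact/ltW/rmetric_posdef.
Qed.

End charts.

(** * Lengths of curves against coordinate displacement *)

Section distance.
Variables (R : realType) (m : nat) (M : topologicalType) (A : smooth_atlas R m M).
Variable rho : riemannian_metric A.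

Local Notation mu := (@lebesgue_measure R).

(* Unlike [ge0_le_integral], no measurability is required. *)
Lemma ge0_le_integral_nonmeas (D1 D2 : set R) (f g : R -> \bar R) :
  D1 `<=` D2 -> (forall x, D1 x -> 0 <= f x)%E -> (forall x, D2 x -> 0 <= g x)%E ->
  (forall x, D1 x -> f x <= g x)%E ->
  (\int[mu]_(x in D1) f x <= \int[mu]_(x in D2) g x)%E.
Proof.
move=> D12 f0 g0 fg; rewrite !ge0_integralE //.
apply: le_ereal_sup => _ [h /= hf <-]; exists h => //= x.
apply: le_trans (hf x) _; rewrite /patch.
case: ifPn => [/set_mem D1x|_]; first by rewrite mem_set ?fg //; exact: D12.
by case: ifPn => // /set_mem /g0.
Qed.

Lemma curve_length_ge0 (c : R -> M) : (0 <= curve_length rho c)%E.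
Proof. by apply: integral_ge0 => t _; rewrite lee_fin sqrtr_ge0. Qed.

Lemma path_length_ge0 p q (L : \bar R) :
  piecewise_smooth_path rho p q L -> (0 <= L)%E.
Proof. by elim=> // c q' L' _ _ ?; rewrite adde_ge0 ?curve_length_ge0. Qed.

(** The fundamental theorem of calculus is applied to each coordinate of the curve on [[0, T]]; with
    the sup norm, bounding the coordinates one by one is enough. *)
Lemma curve_length_lb (c : R -> M) (i : atlas_index A) (k T : R) :
  smooth_curve A c -> 0 <= k -> 0 <= T <= 1 ->
  (forall t, 0 <= t <= T -> chart_dom (A i) (c t)) ->
  (forall t, 0 <= t <= T ->
     k * `|derive1 (chart_map (A i) \o c) t| <= speed rho c t) ->
  ((k * `|chart_map (A i) (c T) - chart_map (A i) (c 0)|)%:E <= curve_length rho c)%E.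
Proof.
move=> cs k0 /andP[]; rewrite le_eqVlt => /predU1P[<- _ _ _|T0 T1 ci ck].
  by rewrite subrr normr0 mulr0 curve_length_ge0.
set x := chart_map (A i) \o c in ck *.
have dx t : 0 <= t <= T -> derivable x t 1.
  by move=> /ci ti; apply/derivable1_diffP; exact: (cs.2 i 1%N).1.
pose f b t := k * derive1 x t 0 b.
have cf b : {within `[0, T], continuous (f b)}.
  apply: continuous_in_subspaceT => t; rewrite inE /= in_itv /= => tT.
  apply: cvgM; first exact: cvg_cst.
  apply: (@continuous_comp _ _ _ (derive1 x) (fun v : 'rV[R]_m => v 0 b) t); last first.
    exact: coord_continuous.
  have -> : derive1 x = 'D_1 x by apply/funext => u; rewrite derive1E.
  by apply: ((cs.2 i 1%N).2 1); exact: ci.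
have dF b t : 0 <= t <= T -> derivable (fun u => k * x u 0 b) t 1.
  move=> /dx dxt; apply: derivableM; first exact: derivable_cst.
  by move/derivable_mxP: dxt; apply.
have dFc b t : 0 <= t <= T -> {for t, continuous (fun u => k * x u 0 b)}.
  by move=> /(dF b) /derivable1_diffP /differentiable_continuous.
have FE b : (\int[mu]_(t in `[0%R, T]) (f b t)%:E = (k * x T 0 b)%:E - (k * x 0 0 b)%:E)%E.
  apply: (@continuous_FTC2 _ (f b) (fun u => k * x u 0 b)) => //.
    split=> [t||].
    - by rewrite in_itv /= => /andP[t0 tT]; apply: dF; rewrite !ltW.
    - apply: cvg_at_right_filter.
      by apply: dFc; rewrite lexx ltW.
    - apply: cvg_at_left_filter.
      by apply: dFc; rewrite lexx ltW.
  move=> t; rewrite in_itv /= => /andP[t0 tT]; rewrite derive1E.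
  have tT' : 0 <= t <= T by rewrite !ltW.
  rewrite deriveM /=; last 2 first.
    exact: derivable_cst.
    by move/derivable_mxP: (dx t tT'); apply.
  rewrite derive_cst scaler0 addr0 /f derive1E derive_mx; last exact: dx.
  by rewrite mxE.
have coord b : (`|k * x T 0 b - k * x 0 0 b|%:E <= curve_length rho c)%E.
  rewrite -abse_EFin EFinB -FE.
  apply: le_trans (le_abse_integral _ _ _) _ => //.
    apply/measurable_realfun.measurable_EFinP.
    apply: measurable_realfun.subspace_continuous_measurable_fun => //.
    exact: cf.
  (* The measurability of [speed], defined through pointwise choices of charts, has not been
     established. *)
  apply: ge0_le_integral_nonmeas.
  - by move=> t /=; rewrite !in_itv /= => /andP[-> tT]; exact: le_trans tT T1.
  - by move=> t _; exact: abse_ge0.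
  - by move=> t _; rewrite lee_fin sqrtr_ge0.
  - move=> t /=; rewrite in_itv /= => tT; rewrite lee_fin.
    apply: le_trans (ck t tT); rewrite normrM (ger0_norm k0) ler_wpM2l //.
    by move: b; apply/rV_norm_leP.
have := curve_length_ge0 c; move: coord.
case: (curve_length rho c) => [l||] coord; [|by rewrite !leey|by rewrite leeNy_eq].
rewrite !lee_fin => l0; rewrite -[k]ger0_norm // -normrZ; apply/rV_norm_leP => // b.
by rewrite scalerBr !mxE -lee_fin coord.
Qed.

End distance.

(** * Short paths stay in a coordinate cube *)

Section chart_cube.
Variables (R : realType) (m : nat) (M : topologicalType) (A : smooth_atlas R m M).
Variables (rho : riemannian_metric A) (hM : hausdorff_space M).
Variables (i : atlas_index A) (y1 : 'rV[R]_m) (s k : R).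
Hypothesis s_img : forall y, `|y - y1| <= s -> chart_img (A i) y.
Hypothesis k_gt0 : 0 < k.
Hypothesis k_lb : forall p (v : 'rV[R]_m),
  chart_dom (A i) p -> `|chart_map (A i) p - y1| <= s ->
  k * `|v| <= Num.sqrt (tensor2_eval rho i p v v).

Let cell b : set M := [set q | chart_dom (A i) q /\ `|chart_map (A i) q - y1| <= b].
Let ocell : set M := [set q | chart_dom (A i) q /\ `|chart_map (A i) q - y1| < s].

(** The cell is the image of a compact cube under [chart_inv], hence closed in all of the Hausdorff
    space [M]. Closedness in the chart domain alone would not stop a curve from leaving the
    chart. *)
Lemma closed_cell b : b <= s -> closed (cell b).
Proof.
move=> bs.
have -> : cell b = chart_inv (A i) @` [set y | `|y - y1| <= b].
  apply/seteqP; split=> [q [iq qb]|_ [y yb <-]].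
    by exists (chart_map (A i) q) => //; exact: chart_mapK_at.
  have iy : chart_img (A i) y by apply: s_img; exact: le_trans yb bs.
  by split; [exact: chart_dom_inv | rewrite chart_invK].
apply: compact_closed => //; apply: continuous_compact; last exact: compact_cube.
apply: continuous_in_subspaceT => y; rewrite inE /= => yb.
by apply: chart_inv_cont; apply: s_img; exact: le_trans yb bs.
Qed.

Lemma open_ocell : open ocell.
Proof.
rewrite openE => q [iq qs]; rewrite /interior.
have h1 : \forall q' \near q, chart_dom (A i) q'.
  by apply: open_nbhs_nbhs; split=> //; exact: chart_dom_open.
have c1 : (fun q' => `|chart_map (A i) q' - y1|) @ q --> `|chart_map (A i) q - y1|.
  apply: cvg_norm; apply: cvgB; last exact: cvg_cst.
  exact: chart_map_cont.
have h2 : \forall q' \near q, `|chart_map (A i) q' - y1| < s.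
  exact: (cvgr_lt _ c1).
by apply: filterS2 h1 h2.
Qed.

(** A first exit argument. While the curve stays in [ocell], its length bounds the displacement and
    keeps it in the smaller [cell (a + l)]. This persists at the infimum [u] of the exit times
    because that cell is closed, and then beyond [u] because [ocell] is open, a contradiction. *)
Lemma curve_cell (c : R -> M) (a l : R) : smooth_curve A c ->
  (curve_length rho c <= (k * l)%:E)%E -> a + l < s -> cell a (c 0) -> cell (a + l) (c 1).
Proof.
move=> cs cl als c0.
have l0 : 0 <= l.
  by have := le_trans (curve_length_ge0 rho c) cl; rewrite lee_fin pmulr_rge0.
have bound T : 0 <= T <= 1 -> (forall t, 0 <= t <= T -> ocell (c t)) -> cell (a + l) (c T).
  move=> T01 hT; have /andP[T0 T1] := T01.
  split; first by apply: (hT _ _).1; rewrite T0 lexx.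
  have : ((k * `|chart_map (A i) (c T) - chart_map (A i) (c 0)|)%:E <= curve_length rho c)%E.
    apply: curve_length_lb => //; first exact: ltW.
      by move=> t /hT[].
    move=> t /hT[ti ts]; rewrite (speed_chart rho cs ti) /=.
    by apply: k_lb => //; exact: ltW.
  move=> /le_trans/(_ cl); rewrite lee_fin ler_pM2l // => h.
  rewrite -(subrKA (chart_map (A i) (c 0))) addrC (le_trans (ler_normD _ _)) //.
  by apply: lerD => //; exact: c0.2.
have c0o : ocell (c 0).
  case: c0 => ic0 c0a; split=> //; apply: le_lt_trans c0a _.
  by apply: le_lt_trans als; rewrite lerDl.
suff allo t : 0 <= t <= 1 -> ocell (c t).
  by apply: bound => [|t t1]; [rewrite ler01 lexx | exact: allo].
move=> t01; apply: contrapT => tZ.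
pose Z := [set t | 0 <= t <= 1 /\ ~ ocell (c t)].
have Z0 : Z !=set0 by exists t.
have Zlb : lbound Z 0 by move=> z [/andP[]].
have hZ : has_inf Z by split=> //; exists 0.
set u := inf Z.
have u0 : 0 <= u by apply: lb_le_inf.
have ut : u <= t by apply: ge_inf => //; exists 0.
have u1 : u <= 1 by apply: le_trans ut _; case/andP: t01.
have below z : 0 <= z -> z < u -> ocell (c z).
  move=> z0 zu; apply: contrapT => zZ; have z1 := ltW (lt_le_trans zu u1).
  move: zu; rewrite ltNge => /negP; apply.
  by apply: ge_inf; [exists 0 | split; rewrite ?z0].
(* The case [u = 0] is the starting point; otherwise times slightly below [u] are used. *)
have cu : ocell (c u).
  move: u0; rewrite le_eqVlt => /predU1P[<- //|u0].
  suff [iu ul] : cell (a + l) (c u) by split=> //; exact: le_lt_trans als.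
  apply: contrapT => ncu.
  have : \forall z \near u, (~` cell (a + l)) (c z).
    apply: cs.1; apply: open_nbhs_nbhs; split=> //; apply: closed_openC.
    exact/closed_cell/ltW.
  move=> /nbhs_ballP[d /= d0 hd].
  pose z := Num.max 0 (u - d / 2).
  have zu : z < u by rewrite /z gt_max u0 /= gtrDl oppr_lt0 divr_gt0.
  have z0 : 0 <= z by rewrite /z le_max lexx.
  apply: (hd z).
    rewrite -ball_normE /= gtr0_norm ?subr_gt0 // ltrBlDr -ltrBlDl.
    by rewrite /z lt_max ltrD2l ltrN2 ltr_pdivrMr // ltr_pMr // ltr1n orbT.
  apply: bound => [|w /andP[w0 wz]].
    by rewrite z0 (le_trans _ u1) // ltW.
  by apply: below => //; exact: le_lt_trans zu.
have : \forall z \near u, ocell (c z).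
  by apply: cs.1; apply: open_nbhs_nbhs; split=> //; exact: open_ocell.
move=> /nbhs_ballP[d /= d0 hd].
have [z [z01 zZ] zu] := inf_adherent d0 hZ.
apply: (zZ); apply: hd; rewrite -ball_normE /= distrC ger0_norm ?ltrBlDl //.
by rewrite subr_ge0; apply: ge_inf; [exists 0 | split].
Qed.

(** Each piece uses up a part [l1] of the budget [l] and enlarges the cell by that amount. *)
Lemma path_cell p q (L : \bar R) : piecewise_smooth_path rho p q L ->
  forall a l : R, (L <= (k * l)%:E)%E -> a + l < s -> cell a p -> cell (a + l) q.
Proof.
elim=> [{}p a l|c {}q {}L cs pL IH a l cLl als c0].
  rewrite lee_fin pmulr_rge0 // => l0 _ [ip pa]; split=> //.
  by apply: le_trans pa _; rewrite lerDl.
have L0 := path_length_ge0 pL; have c_0 := curve_length_ge0 rho c.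
have cfin : curve_length rho c \is a fin_num.
  rewrite ge0_fin_numE //; apply: le_lt_trans (ltry (k * l)).
  by apply: le_trans cLl; rewrite leeDl.
pose l1 := fine (curve_length rho c) / k.
have cl1 : curve_length rho c = (k * l1)%:E.
  by rewrite /l1 mulrCA divff ?mulr1 ?fineK // gt_eqF.
have Ll : (L <= (k * (l - l1))%:E)%E.
  move: cLl; rewrite cl1; case: (L) => [x||] //; last by move=> _; rewrite leNye.
  by rewrite -EFinD !lee_fin; lra.
have Ll0 : l1 <= l.
  by have := le_trans L0 Ll; rewrite lee_fin pmulr_rge0 // subr_ge0.
have -> : a + l = (a + l1) + (l - l1) by lra.
apply: IH => //; first lra.
apply: curve_cell => //; first by rewrite cl1.
lra.
Qed.

(** Converts a small Riemannian distance into closeness in coordinates; in particular [q] cannot lie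
    outside the chart. The distance being an infimum, the strict inequality provides a path shorter
    than [k * l]. *)
Lemma riem_dist_cell p q (l : R) :
  chart_dom (A i) p -> chart_map (A i) p = y1 -> (riem_dist rho p q < (k * l)%:E)%E ->
  l < s -> chart_dom (A i) q /\ `|chart_map (A i) q - chart_map (A i) p| <= l.
Proof.
move=> ip py /ereal_inf_lt[L /= pL Ll] ls; rewrite py.
rewrite -[l]add0r; apply: (path_cell pL); first exact: ltW.
  by rewrite add0r.
by split=> //; rewrite py subrr normr0.
Qed.

End chart_cube.

(** * Poisson brackets in charts *)

Section brackets.
Variables (R : realType) (m : nat) (M : topologicalType) (A : smooth_atlas R m M).
Implicit Types (i j : atlas_index A) (p : M) (f g : M -> R).

Lemma partial_chart f i j p (a : 'I_m) :
  chart_dom (A i) p -> chart_dom (A j) p ->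
  differentiable (f \o chart_inv (A j)) (chart_map (A j) p) ->
  partial a (f \o chart_inv (A i)) (chart_map (A i) p) =
  \sum_b jacobian (transition (A i) (A j)) (chart_map (A i) p) a b *
         partial b (f \o chart_inv (A j)) (chart_map (A j) p).
Proof.
move=> ip jp df; have dT := differentiable_transition ip jp.
have iK := chart_mapK_at ip.
have Ty : transition (A i) (A j) (chart_map (A i) p) = chart_map (A j) p.
  by rewrite /transition /= iK.
rewrite /partial.
have -> : 'D_(delta_mx 0 a) (f \o chart_inv (A i)) (chart_map (A i) p) =
  'D_(delta_mx 0 a) ((f \o chart_inv (A j)) \o transition (A i) (A j)) (chart_map (A i) p).
  apply: near_eq_derive.
  have : \forall y \near chart_map (A i) p, chart_dom (A j) (chart_inv (A i) y).
    apply: (chart_inv_cont (chart_img_map ip)); rewrite /= iK.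
    by apply: open_nbhs_nbhs; split=> //; exact: chart_dom_open.
  by apply: filterS => y jy; rewrite /transition /= chart_mapK_at.
rewrite deriveE; last by apply: differentiable_comp; rewrite ?Ty.
rewrite diff_comp ?Ty //= -mul_rV_lin1 -rowE [X in 'd _ _ X]row_sum_delta linear_sum /=.
by apply: eq_bigr => b _; rewrite linearZ /= deriveE // mxE.
Qed.

Lemma jac_chart (F : 'I_m -> M -> R) i j p :
  chart_dom (A i) p -> chart_dom (A j) p ->
  (forall b, differentiable (F b \o chart_inv (A j)) (chart_map (A j) p)) ->
  jac (fun b => F b \o chart_inv (A i)) (chart_map (A i) p) =
  jacobian (transition (A i) (A j)) (chart_map (A i) p) *m
    jac (fun b => F b \o chart_inv (A j)) (chart_map (A j) p).
Proof.
move=> ip jp dF; apply/matrixP => a b; rewrite !mxE (partial_chart _ ip jp) //.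
by apply: eq_bigr => c _; congr (_ * _); rewrite mxE.
Qed.

Variable omega : symplectic_form A.

Lemma chart_atP p : chart_dom (A (chart_at A p)) p.
Proof. by rewrite /chart_at; case: cid. Qed.

Lemma poisson_bracketE f g p (i := chart_at A p) :
  poisson_bracket omega f g p =
  (differential f i p *m (invmx (omega i (chart_map (A i) p)))^T *m
    (differential g i p)^T) 0 0.
Proof.
rewrite /poisson_bracket /tensor2_eval /hamiltonian_vf -/i.
have /(sform_nondegenerate omega) u : chart_img (A i) (chart_map (A i) p).
  exact/chart_img_map/chart_atP.
have gen (v w : 'rV[R]_m) (W : 'M[R]_m) : W \in unitmx ->
    - v *m invmx W *m W *m (- w *m invmx W)^T = v *m (invmx W)^T *m w^T.
  move=> Wu; rewrite mulmxKV // trmx_mul (raddfN (@trmx R 1 m)) /=.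
  by rewrite mulmxN mulNmx mulmxN opprK mulmxA.
by rewrite gen.
Qed.

(** In the chart chosen at [p] the matrix of brackets is [D^T *m (invmx W)^T *m D]. Passing to chart
    [i] multiplies both sides by the squared determinant of the Jacobian of the transition. *)
Lemma det_poisson_bracket (F : 'I_m -> M -> R) i p :
  chart_dom (A i) p ->
  (forall b j, chart_dom (A j) p ->
     differentiable (F b \o chart_inv (A j)) (chart_map (A j) p)) ->
  \det (jac (fun b => F b \o chart_inv (A i)) (chart_map (A i) p)) ^+ 2 =
  \det (\matrix_(b, c) poisson_bracket omega (F b) (F c) p) *
  \det (omega i (chart_map (A i) p)).
Proof.
move=> ip dF; pose j := chart_at A p; have jp : chart_dom (A j) p := chart_atP p.
pose D := jac (fun b => F b \o chart_inv (A j)) (chart_map (A j) p).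
pose W := omega j (chart_map (A j) p).
have -> : \matrix_(b, c) poisson_bracket omega (F b) (F c) p = D^T *m (invmx W)^T *m D.
  apply/matrixP => b c; rewrite mxE poisson_bracketE -/j -/W [LHS]mxE [RHS]mxE.
  apply: eq_bigr => e _; rewrite [in LHS]mxE [in RHS]mxE; congr (_ * _).
    by apply: eq_bigr => d _; rewrite !mxE.
  by rewrite !mxE.
have Wu : W \in unitmx by apply/sform_nondegenerate/chart_img_map.
have W0 : \det W != 0 by rewrite -unitfE -unitmxE.
rewrite (jac_chart ip jp (fun b => dF b j jp)) (tensor2_compat omega ip jp) -/D -/W.
rewrite !det_mulmx !det_tr det_inv.
by field.
Qed.

Lemma lin_comb_differentiable (I : finType) (f : I -> M -> R) (x : I -> R) i y :
  (forall l, smooth_fun A (f l)) -> chart_img (A i) y ->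
  differentiable (lin_comb x f \o chart_inv (A i)) y.
Proof.
move=> fs iy.
have -> : lin_comb x f \o chart_inv (A i) = \sum_l (x l *: (f l \o chart_inv (A i))).
  by apply/funext => z; rewrite fct_sumE /lin_comb.
elim/big_ind : _ => [|g h dg dh|l _].
- exact: differentiable_cst.
- exact: differentiableD.
- by apply: differentiableZ; exact: (fs l i 1%N).1.
Qed.

Lemma partial_lin_comb (I : finType) (f : I -> M -> R) (x : I -> R) i y (a : 'I_m) :
  (forall l, smooth_fun A (f l)) -> chart_img (A i) y ->
  partial a (lin_comb x f \o chart_inv (A i)) y =
  \sum_l x l * partial a (f l \o chart_inv (A i)) y.
Proof.
move=> fs iy.
have -> : lin_comb x f \o chart_inv (A i) = \sum_l (x l *: (f l \o chart_inv (A i))).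
  by apply/funext => z; rewrite fct_sumE /lin_comb.
have df l : derivable (f l \o chart_inv (A i)) y (delta_mx 0 a).
  by apply: diff_derivable; exact: (fs l i 1%N).1.
rewrite /partial.
have [_ ->] : derivable (\sum_l (x l *: (f l \o chart_inv (A i)))) y (delta_mx 0 a) /\
  'D_(delta_mx 0 a) (\sum_l (x l *: (f l \o chart_inv (A i)))) y =
  \sum_l x l * 'D_(delta_mx 0 a) (f l \o chart_inv (A i)) y; last by [].
elim/big_ind2 : _ => [|g1 g2 h1 h2 [dg eg] [dh eh]|l _].
- by split; [exact: derivable_cst | rewrite derive_cst].
- by split; [exact: derivableD | rewrite deriveD // eg eh].
- by split; [exact: derivableZ | rewrite deriveZ].
Qed.

Lemma partial_lin_comb_continuous (I : finType) (f : I -> M -> R) (x : I -> R) i y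
    (a : 'I_m) :
  (forall l, smooth_fun A (f l)) -> chart_img (A i) y ->
  {for y, continuous (partial a (lin_comb x f \o chart_inv (A i)))}.
Proof.
move=> fs iy; pose g z := \sum_l x l * partial a (f l \o chart_inv (A i)) z.
have gE z : chart_img (A i) z -> g z = partial a (lin_comb x f \o chart_inv (A i)) z.
  by move=> iz; rewrite partial_lin_comb.
have gc : g @ y --> g y.
  apply: (@cvg_sumr R _ (nbhs y) I
    (fun l z => x l * partial a (f l \o chart_inv (A i)) z)) => l.
  apply: cvgM; first exact: cvg_cst.
  exact: (fs l i 1%N).2.
rewrite (gE y iy) in gc; apply: cvg_trans gc.
apply: near_eq_cvg; first exact: (@nbhs_filter _ y).
have : \forall z \near y, chart_img (A i) z.
  by apply: open_nbhs_nbhs; split=> //; exact: chart_img_open.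
by apply: filterS => z /gE ->.
Qed.

End brackets.

(** * Locality of the brackets of a partition of unity *)

Section localization.
Variables (R : realType) (m : nat) (M : topologicalType) (A : smooth_atlas R m M).
Variables (omega : symplectic_form A) (I : finType) (U : I -> set M) (f : I -> M -> R).
Hypotheses (fP : partition_of_unity A f) (fU : subordinate f U).

(** The support is closed and contained in [U l], so [f l] vanishes in a neighbourhood of [p], not
    merely at [p]. *)
Lemma partial_eq0 (i : atlas_index A) p l (a : 'I_m) :
  chart_dom (A i) p -> ~ U l p -> partial a (f l \o chart_inv (A i)) (chart_map (A i) p) = 0.
Proof.
move=> ip Ulp; rewrite /partial -[RHS](derive_cst 0 (chart_map (A i) p) (delta_mx 0 a)).
apply: near_eq_derive.
have : \forall y \near chart_map (A i) p,
    (~` closure [set q | f l q != 0]) (chart_inv (A i) y).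
  apply: (chart_inv_cont (chart_img_map ip)); rewrite /= chart_mapK_at //.
  apply: open_nbhs_nbhs; split; first exact/closed_openC/closed_closure.
  by move/fU.
apply: filterS => y /= fy; apply/eqP; apply: contra_notT fy => fy0.
exact: subset_closure.
Qed.

Lemma sum_partial_eq0 (i : atlas_index A) p (a : 'I_m) :
  chart_dom (A i) p -> \sum_l partial a (f l \o chart_inv (A i)) (chart_map (A i) p) = 0.
Proof.
move=> ip; have [fs _ f1] := fP.
transitivity (partial a (lin_comb (fun=> 1) f \o chart_inv (A i)) (chart_map (A i) p)).
  rewrite partial_lin_comb //; last exact: chart_img_map.
  by apply: eq_bigr => l _; rewrite mul1r.
have -> : lin_comb (fun=> 1) f \o chart_inv (A i) = cst 1.
  apply/funext => y; rewrite /= /lin_comb -[RHS](f1 (chart_inv (A i) y)).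
  by apply: eq_bigr => l _; rewrite mul1r.
by rewrite /partial derive_cst.
Qed.

(* Constants have zero differential and f_l has zero differential off U_l, so
   only the oscillation of the coefficients over the U_l containing p matters. *)
Lemma poisson_bracket_local_bound p (C d : R) (x y : I -> R) (cx cy : R) :
  0 < d ->
  (forall x' y', unit_cube x' -> unit_cube y' ->
     `|poisson_bracket omega (lin_comb x' f) (lin_comb y' f) p| <= C) ->
  (forall l, U l p -> `|x l - cx| <= d) -> (forall l, U l p -> `|y l - cy| <= d) ->
  `|poisson_bracket omega (lin_comb x f) (lin_comb y f) p| <= d ^+ 2 * C.
Proof.
move=> d0 hC hx hy; have [fs _ _] := fP; set i := chart_at A p.
have ip : chart_dom (A i) p by exact: chart_atP.
(* The coefficients are recentred at [c], which is harmless because the differentials of the [f l]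
   sum to 0, then rescaled into [[-1, 1]], and set to 0 where the differential of [f l] vanishes at
   [p]. *)
pose loc (z : I -> R) c l := if p \in U l then (z l - c) / d else 0.
have loc_cube z c : (forall l, U l p -> `|z l - c| <= d) -> unit_cube (loc z c).
  move=> hz l; rewrite -ler_norml /loc; case: ifPn => [/set_mem /hz h|_].
    by rewrite normrM normfV (gtr0_norm d0) ler_pdivrMr // mul1r.
  by rewrite normr0 ler01.
have diffE z c : differential (lin_comb z f) i p = d *: differential (lin_comb (loc z c) f) i p.
  apply/rowP => a; rewrite !mxE !partial_lin_comb //; try exact: chart_img_map.
  transitivity (\sum_l (z l - c) * partial a (f l \o chart_inv (A i)) (chart_map (A i) p)).
    under [RHS]eq_bigr do rewrite mulrBl.
    by rewrite sumrB -mulr_sumr sum_partial_eq0 // mulr0 subr0.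
  rewrite mulr_sumr; apply: eq_bigr => l _; rewrite /loc.
  case: ifPn => [_|/negP Ul]; first by rewrite mulrA mulrCA divff ?mulr1 // gt_eqF.
  by rewrite partial_eq0 ?mulr0 // => h; apply: Ul; rewrite inE.
rewrite poisson_bracketE -/i (diffE x cx) (diffE y cy) linearZ /=.
rewrite -!scalemxAl -scalemxAr scalerA mxE -poisson_bracketE.
rewrite normrM -expr2 normrX (gtr0_norm d0).
apply: ler_wpM2l; first by rewrite exprn_ge0 // ltW.
by apply: hC; exact: loc_cube.
Qed.

End localization.

(** * The bracket invariant of a fine cover *)

Lemma clamp_lipschitz (R : realType) (u v : R) :
  `|Num.max 0 (Num.min 1 u) - Num.max 0 (Num.min 1 v)| <= `|u - v|.
Proof.
have h a b : a <= b -> `|Num.max 0 (Num.min 1 a) - Num.max 0 (Num.min 1 b)| <= `|a - b| :> R.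
  move=> ab; rewrite !maxEle !minEle.
  rewrite (ler0_norm (_ : a - b <= 0)) ?subr_le0 // ler_norml.
  by case: (leP 1 a); case: (leP 1 b); rewrite ?ler01;
     case: (leP 0 a); case: (leP 0 b) => *; apply/andP; split; lra.
by case: (leP u v) => [/h//|/ltW/h]; rewrite distrC [X in _ <= X -> _]distrC.
Qed.

(** The estimate takes place in a single chart around an arbitrary point; the threshold [eps0] is
    fixed before the cover. *)
Lemma pb_lower_bound (R : realType) (m : nat) (M : topologicalType)
    (A : smooth_atlas R m M) (omega : symplectic_form A) (rho : riemannian_metric A)
    (C : R) :
  (0 < m)%N -> closed_manifold A -> 0 < C ->
  exists2 eps0 : R, 0 < eps0 & forall (eps : R) (I : finType) (U : I -> set M),
    0 < eps < eps0 -> (forall l, (riem_diam rho (U l) <= eps%:E)%E) ->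
    (C%:E <= pb omega U)%E.
Proof.
move=> m0 [[p0 _] hausM _] C0.
pose i := chart_at A p0; pose x := chart_map (A i); pose y0 := x p0.
(* Radius [2 * s] leaves room for a cube of radius [s] around each point of the working cube of
   radius [s]. *)
have [s s0 s_img] : exists2 s : R, 0 < s & forall y, `|y - y0| <= 2 * s -> chart_img (A i) y.
  have : nbhs y0 (chart_img (A i)).
    apply: open_nbhs_nbhs; split; first exact: chart_img_open.
    exact/chart_img_map/chart_atP.
  move=> /nbhs_ballP[r /= r0 hr]; exists (r / 4); first by rewrite divr_gt0.
  move=> y hy; apply: hr; rewrite -ball_normE /= distrC; apply: le_lt_trans hy _.
  by lra.
have s2_gt0 : 0 < 2 * s by rewrite mulr_gt0.
have [k k0 k_lb] := metric_lb rho (compact_cube (y0 := y0) (s := 2 * s)) s_img.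
have [B [B0 HB]] : exists B, 0 <= B /\ forall y, `|y - y0| <= s -> `|omega i y| <= B.
  have hB := @compact_norm_bounded R _ _ _ (omega i) (compact_cube (y0 := y0) (s := s)) _.
  have {}hB : \forall B \near +oo, forall y, `|y - y0| <= s -> `|omega i y| <= B.
    apply: hB => y /= ys; apply: (tensor2_smooth omega i 0%N); apply: s_img.
    by apply: le_trans ys _; rewrite ler_pMl // ler1n.
  by have [B' [/= ? ?]] := filter_ex (filterI (nbhs_pinfty_ge (num_real 0)) hB); exists B'.
pose W : R := m`!%:R * B ^+ m; pose v : R := (2 * s) ^+ m.
have W0 : 0 <= W by rewrite mulr_ge0 ?exprn_ge0.
have v0 : 0 < v by rewrite exprn_gt0.
have G0 : 0 <= m`!%:R * W * v ^+ 2.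
  by apply: mulr_ge0; [exact: mulr_ge0 | exact: sqr_ge0].
(* Chosen for the inequality [thC] below; the final [+ 1] gives [K >= 1], hence [th <= 1 / 2]. *)
pose K : R := C * (1 + 4 * (m`!%:R * W * v ^+ 2)) + 1.
have K1 : 1 <= K.
  by rewrite /K lerDr; apply: mulr_ge0; [exact: ltW | rewrite addr_ge0 // mulr_ge0].
have K0 : 0 < K := lt_le_trans ltr01 K1.
pose th := (2 * K)^-1; have th0 : 0 < th by rewrite invr_gt0 mulr_gt0.
have th2 : th <= 1 / 2.
  by rewrite /th div1r lef_pV2 ?posrE ?mulr_gt0 // ler_peMr.
(* From a point of the working cube, a set of smaller diameter extends by at most [th * s] in
   coordinates, see [near_p]. *)
exists (th * s * k / 2); first by rewrite !mulr_gt0.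
move=> eps I U /andP[eps0 epslt] diamU; rewrite leNgt; apply/negP.
move=> /ereal_inf_lt[_ [f [fP fU] <-]] supC.
have [fs f0 f1] := fP.
have hC p (a b : I -> R) : unit_cube a -> unit_cube b ->
    `|poisson_bracket omega (lin_comb a f) (lin_comb b f) p| <= C.
  move=> ca cb; rewrite -lee_fin; apply: le_trans (ltW supC).
  apply: le_trans (ereal_sup_ubound _); last by exists (a, b).
  by apply: ereal_sup_ubound; exists p.
have near_p p q l : chart_dom (A i) p -> `|x p - y0| <= s -> U l p -> U l q ->
    chart_dom (A i) q /\ `|x q - x p| <= th * s.
  move=> ip ps Up Uq.
  apply: (@riem_dist_cell _ _ _ _ rho hausM i (x p) s k) => //.
  - move=> y ys; apply: s_img; rewrite -(subrKA (x p)) (le_trans (ler_normD _ _)) //.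
    by rewrite mulr_natl mulr2n lerD.
  - move=> q' v' iq' q's; apply: k_lb => //=.
    rewrite -(subrKA (x p)) (le_trans (ler_normD _ _)) //.
    by rewrite mulr_natl mulr2n lerD.
  - apply: (@le_lt_trans _ _ eps%:E).
      apply: le_trans (diamU l); apply: ereal_sup_ubound; exists (p, q) => //.
    rewrite lte_fin; apply: lt_trans epslt _.
    have : 0 < th * s * k by rewrite !mulr_gt0.
    by lra.
  - by rewrite gtr_pMl //; apply: le_lt_trans th2 _; lra.
(* An empty [U l] gets the default [p0]; then [f l] is identically 0 and the value is irrelevant. *)
pose pt l := xget p0 (U l).
have ptU l p : U l p -> U l (pt l) by move=> Up; exact: (xgetPex p0 (ex_intro _ p Up)).
(* Equal to 0 at distance [s / 2] or more below the centre and to 1 at [s / 2] or more above it.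
   Since [th * s <= s / 2], replacing points by the [pt l] keeps [Psi b] exactly 0 and 1 on the
   faces. *)
pose H b q := Num.max 0 (Num.min 1 ((x q 0 b - y0 0 b) / s + 1 / 2)).
pose Psi b := lin_comb (fun l => H b (pt l)) f.
have HLip p b l : chart_dom (A i) p -> `|x p - y0| <= s -> U l p ->
    `|H b (pt l) - H b p| <= th.
  move=> ip ps Up; apply: le_trans (clamp_lipschitz _ _) _.
  have [_ ptp] := near_p p (pt l) l ip ps Up (ptU l p Up).
  have -> : (x (pt l) 0 b - y0 0 b) / s + 1 / 2 - ((x p 0 b - y0 0 b) / s + 1 / 2) =
     (x (pt l) - x p) 0 b / s.
    by rewrite !mxE; ring.
  rewrite normrM normfV (gtr0_norm s0) ler_pdivrMr //.
  by move: b; apply/rV_norm_leP => //; rewrite mulr_ge0 // ltW.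
have ths0 : 0 <= th * s by rewrite mulr_ge0 // ltW.
have sK y : `|y - y0| <= s -> chart_img (A i) y.
  by move=> ys; apply: s_img; apply: le_trans ys _; rewrite ler_pMl // ler1n.
have [y ys] : exists2 y, `|y - y0| <= s &
    1 / 2 <= v * `|\det (jac (fun b => Psi b \o chart_inv (A i)) y)|.
  apply: jac_det_lb => // [b y ys|a b y ys|b y ys].
  - exact: lin_comb_differentiable (sK y ys).
  - exact: partial_lin_comb_continuous (sK y ys).
  - pose p := chart_inv (A i) y.
    have ip : chart_dom (A i) p by exact: chart_dom_inv (sK y ys).
    have xp : x p = y by exact: chart_invK (sK y ys).
    have act l : U l p \/ f l p = 0.
      have [Ulp|nU] := pselect (U l p); [by left | right].
      apply/eqP; apply: contra_notT nU => flp; apply: (fU l).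
      exact: subset_closure.
    have close l : U l p -> `|x (pt l) 0 b - y 0 b| <= s / 2.
      have ps : `|x p - y0| <= s by rewrite xp.
      move=> Up; have [_] := near_p p (pt l) l ip ps Up (ptU l p Up); rewrite xp => /(rV_norm_leP _ ths0)/(_ b); rewrite !mxE => h.
      apply: le_trans h _; rewrite mulrC [s / 2]mulrC -[2^-1]div1r mulrC.
      by rewrite ler_pM2r.
    split=> yb.
      rewrite /= /Psi /lin_comb big1 // => l _; have [Up|->] := act l; last by rewrite mulr0.
      have : H b (pt l) = 0; last by move=> ->; rewrite mul0r.
      have := close l Up; rewrite yb ler_norml => /andP[_ h].
      rewrite /H; apply/max_idPl; rewrite ge_min; apply/orP; right.
      rewrite -lerBrDr sub0r ler_pdivrMr //; lra.
    rewrite /= /Psi /lin_comb -[RHS](f1 p); apply: eq_bigr => l _.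
    have [Up|flp] := act l; last by rewrite flp mulr0.
    have -> : H b (pt l) = 1; last by rewrite mul1r.
    have := close l Up; rewrite yb ler_norml => /andP[h _].
    rewrite /H (_ : Num.min _ _ = 1); first by apply/max_idPr.
    apply/min_idPl; rewrite -lerBlDr ler_pdivlMr //; lra.
pose p := chart_inv (A i) y.
have ip : chart_dom (A i) p by exact: chart_dom_inv (sK y ys).
have xp : x p = y by exact: chart_invK (sK y ys).
set J := \det _ => hJ.
(* The coefficients of [Psi] oscillate by at most [th] near [p], so each bracket is at most
   [th ^+ 2 * C]; the cruder [th * C] is enough for divergence. *)
have : J ^+ 2 <= (m`!%:R * (th * C) ^+ m) * W.
  have := @det_poisson_bracket R m M A omega Psi i p ip.
  rewrite -/x xp -/J => ->; last first.
    by move=> b j jp; apply: lin_comb_differentiable => //; exact: chart_img_map.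
  apply: le_trans (ler_norm _) _; rewrite normrM; apply: ler_pM => //.
    apply: norm_det_le => b c; rewrite mxE.
    apply: (@le_trans _ _ (th ^+ 2 * C)).
      apply: (poisson_bracket_local_bound (cx := H b p) (cy := H c p) fP fU) => //.
      - by move=> a a'; exact: hC.
      - by move=> l; apply: HLip => //; rewrite xp.
      - by move=> l; apply: HLip => //; rewrite xp.
    by rewrite ler_pM2r // expr2 ler_piMr; [|exact: ltW|lra].
  apply: norm_det_le => a b; apply: le_trans (HB y ys).
  rewrite [leRHS]/Num.Def.normr /= mx_normrE.
  exact: (@le_bigmax _ _ _ _ (fun ab => `|omega i y ab.1 ab.2|) (a, b)).
have thC0 : 0 <= th * C by apply: mulr_ge0; exact: ltW.
have thC : th * C * (1 + 4 * (m`!%:R * W * v ^+ 2)) <= 1 / 2.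
  rewrite -mulrA (@le_trans _ _ (th * K)) //.
    by apply: ler_wpM2l; [exact: ltW | rewrite /K lerDl].
  by rewrite /th invfM -mulrA mulVf ?mulr1 ?div1r // gt_eqF.
have thC1 : (th * C) ^+ m <= th * C.
  have h1 : th * C <= 1.
    apply: le_trans (_ : th * C * (1 + 4 * (m`!%:R * W * v ^+ 2)) <= 1); last by lra.
    by rewrite ler_peMr // lerDl mulr_ge0.
  by rewrite -[leRHS]expr1; apply: ler_wiXn2l.
have vJ : 1 / 4 <= v ^+ 2 * J ^+ 2.
  rewrite -exprMn -[leRHS]real_normK ?num_real // normrM (gtr0_norm v0).
  have -> : 1 / 4 = (1 / 2) ^+ 2 :> R by field.
  by rewrite ler_sqr ?nnegrE // mulr_ge0 // ltW.
move=> hJ2.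
have : v ^+ 2 * J ^+ 2 <= th * C * (m`!%:R * W * v ^+ 2).
  have -> : th * C * (m`!%:R * W * v ^+ 2) = v ^+ 2 * (m`!%:R * (th * C) * W) by ring.
  apply: ler_wpM2l; first exact: sqr_ge0.
  apply: le_trans hJ2 _.
  by rewrite ler_wpM2r // ler_wpM2l.
(* The two bounds give [1 / 4 <= g], whereas [thC] gives [4 * g <= 1 / 2]. *)
move: thC; rewrite mulrDr mulr1 mulrCA; move: thC0 vJ.
set g := th * C * (_ * _); set g' := th * C; set g'' := v ^+ 2 * _.
lra.
Qed.

Theorem proposition1p14 (R : realType) (n : nat) (hn : (1 <= n)%N)
    (M : topologicalType) (A : smooth_atlas R (2 * n)%N M)
    (hM : closed_manifold A)
    (omega : symplectic_form A) (rho : riemannian_metric A)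
    (I : R -> finType) (U : forall eps : R, I eps -> set M)
    (hU : forall eps : R, 0 < eps ->
       open_cover (U eps) /\
       (forall i : I eps, (riem_diam rho (U eps i) <= eps%:E)%E)) :
  pb omega (U eps) @[eps --> 0^'+] --> (+oo)%E.
Proof.
have m0 : (0 < 2 * n)%N by rewrite muln_gt0.
(* [C] is positive, as [pb_lower_bound] requires, and strictly above [C0]. *)
apply/cvgeyPgt => C0; pose C := Num.max C0 0 + 1.
have CC0 : C0 < C by rewrite (le_lt_trans (_ : _ <= Num.max C0 0)) ?le_max ?lexx // ltrDl.
have C_gt0 : 0 < C by rewrite ltr_wpDl // le_max lexx orbT.
have [eps0 eps0_gt0 h] := pb_lower_bound omega rho m0 hM C_gt0.
near=> eps; apply: (@lt_le_trans _ _ C%:E); first by rewrite lte_fin.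
apply: h; first by apply/andP; split; near: eps; [exact: nbhs_right_gt | exact: nbhs_right_lt].
by have [|_] := hU eps; [near: eps; exact: nbhs_right_gt | apply].
Unshelve. all: by end_near.
Qed.
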